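(* Let $D=\{(z,w)\in\mathbb{C}\times\mathbb{P}^1: a(z)w^2+b(z)w+c(z)=0\}$ be a double section over $\mathbb{C}$, with $a,b,c$ entire functions. Let $\sigma:\mathbb{C}\to\mathbb{P}^1$ be a holomorphic map whose graph does not meet $D$ (such a map exists by a theorem of Buzzard and Lu). For every entire function $u$, let $\psi^u$ be the complex flow on $\mathbb{C}\times\mathbb{P}^1$ of the complete vector field $$W^u=e^{u(z)}\,[a(z)w^2+b(z)w+c(z)]\,\frac{\partial}{\partial w}.$$ Then the family $\{g^u\}_u$, indexed by all entire functions $u$, of holomorphic maps $$g^u(z,t)=\psi^u(t,z,\sigma(z)),\qquad (z,t)\in\mathbb{C}^2,$$ is a family of fiber-preserving dominating maps from $\mathbb{C}^2$ onto $(\mathbb{C}\times\mathbb{P}^1)\setminus D$.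
   Context: A double section over $\mathbb{C}$ is a one-dimensional complex subvariety of $\mathbb{C}\times\mathbb{P}^1$ defined by an equation $a(z)w^2+b(z)w+c(z)=0$ with $a,b,c$ holomorphic on $\mathbb{C}$ (homogenized in $w\in\mathbb{P}^1$). The vector field $W^u$ extends holomorphically across $\{w=\infty\}$. $\psi^u(t,z,w)$ is the value at complex time $t$ of the solution of $W^u$ starting at $(z,w)$ at time $0$. A holomorphic map from $\mathbb{C}^2$ to a complex surface is dominating if its Jacobian determinant is not identically zero; it is fiber-preserving if it has the form $(z,t)\mapsto(z,\cdot)$. *)

(* Defs.v *)
From HB Require Import structures.
From mathcomp Require Import all_boot all_order all_algebra.
From mathcomp Require Import all_classical all_reals all_analysis.
From mathcomp Require Import complex.
From mathcomp Require Import ring.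
Set Implicit Arguments.
Unset Strict Implicit.
Unset Printing Implicit Defensive.
Import Order.TTheory GRing.Theory Num.Theory.
Import numFieldNormedType.Exports.
Local Open Scope classical_set_scope.
Local Open Scope ring_scope.

(* The complex line as a normed module over the field R[i]: [differentiable],
   [is_derive] and 'D_v below are therefore all complex-linear notions. *)
Notation Cline R := (R[i]%type^o).

(* The Riemann sphere: [Some w] is the point [w : 1], [None] is [1 : 0]. *)
Definition P1 (R : realType) : topologicalType :=
  one_point_compactification (Cline R).

Definition P1zero {R : realType} : P1 R := Some 0.
Definition P1infty {R : realType} : P1 R := None.

Definition hcoord {R : realType} (p : P1 R) : Cline R * Cline R :=
  if p is Some w then (w, 1) else (1, 0).

(* The affine coordinate w; the value at P1infty is junk. *)
Definition wcoord {R : realType} (p : P1 R) : Cline R :=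
  if p is Some w then w else 0.

(* The coordinate v = 1/w, with v = 0 at P1infty; the value at P1zero is
   junk. *)
Definition vcoord {R : realType} (p : P1 R) : Cline R :=
  if p is Some w then w^-1 else 0.

Definition cexp {R : realType} (z : Cline R) : Cline R :=
  let: Complex x y := z in Complex (expR x * cos y) (expR x * sin y).

Definition entire {R : realType} (f : Cline R -> Cline R) : Prop :=
  forall z, differentiable f z.

Definition holomorphic_P1 {R : realType} {V : normedModType R[i]}
    (f : V -> P1 R) : Prop :=
  [/\ continuous f,
      forall x, f x <> P1infty -> differentiable (wcoord \o f) x
    & forall x, f x <> P1zero -> differentiable (vcoord \o f) x].

Definition holomorphic_CP1 {R : realType} {V : normedModType R[i]}
    (F : V -> Cline R * P1 R) : Prop :=
  (forall x, differentiable (fst \o F) x) /\ holomorphic_P1 (snd \o F).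

(* The zero locus of the homogenized equation a x^2 + b x y + c y^2 = 0 at
   [x : y] = p.2.  Being cut out by one equation in a connected surface, and
   meeting every fibre, it is one-dimensional unless it is everything. *)
Definition double_section {R : realType} (a b c : Cline R -> Cline R) :
    set (Cline R * P1 R) :=
  [set p | let: (x, y) := hcoord p.2 in
     a p.1 * x ^+ 2 + b p.1 * (x * y) + c p.1 * y ^+ 2 = 0].

(* A vector field on C x P^1 tangent to the fibres {z} x P^1, given by its
   components in the two charts:
     vf_w z w d/dw  on {w != oo}   and   vf_v z v d/dv  on {w != 0}.
   The coherence condition is the change of variables d/dw = - v^2 d/dv. *)
Record vertical_field (R : realType) := VerticalField {
  vf_w : Cline R -> Cline R -> Cline R;
  vf_v : Cline R -> Cline R -> Cline R;
  vf_coherent : forall z v, v != 0 -> vf_v z v = - v ^+ 2 * vf_w z v^-1 }.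

Lemma W_coherent {R : realType} (a b c u : Cline R -> Cline R) :
  forall z v : Cline R, v != 0 ->
  - (cexp (u z) * (a z + b z * v + c z * v ^+ 2)) =
  - v ^+ 2 * (cexp (u z) * (a z * v^-1 ^+ 2 + b z * v^-1 + c z)).
Proof.
move=> z v v0; set e := cexp _; move: (a z) (b z) (c z) => {}a {}b {}c.
have v0' : (v : R[i]) != 0 by [].
by move: (e : R[i]) (a : R[i]) (b : R[i]) (c : R[i]) (v : R[i]) v0'
  => {}e {}a {}b {}c {v0} v v0; field.
Qed.

(* W^u = e^u (a w^2 + b w + c) d/dw and its extension across {w = oo}. *)
Definition W {R : realType} (a b c u : Cline R -> Cline R) :
    vertical_field R :=
  @VerticalField R
    (fun z w => cexp (u z) * (a z * w ^+ 2 + b z * w + c z))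
    (fun z v => - (cexp (u z) * (a z + b z * v + c z * v ^+ 2)))
    (W_coherent a b c u).

(* Integral curves in complex time, defined for all times. *)
Definition integral_curve {R : realType} (X : vertical_field R)
    (gam : Cline R -> Cline R * P1 R) : Prop :=
  holomorphic_CP1 gam /\
  forall t : Cline R,
  [/\ is_derive t 1 (fst \o gam) 0,
      (gam t).2 <> P1infty ->
        is_derive t 1 (wcoord \o (snd \o gam))
          (vf_w X (gam t).1 (wcoord (gam t).2))
    & (gam t).2 <> P1zero ->
        is_derive t 1 (vcoord \o (snd \o gam))
          (vf_v X (gam t).1 (vcoord (gam t).2))].

Definition complete_field {R : realType} (X : vertical_field R) : Prop :=
  forall p, exists gam, integral_curve X gam /\ gam 0 = p.

Definition is_flow {R : realType} (X : vertical_field R)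
    (psi : Cline R -> Cline R * P1 R -> Cline R * P1 R) : Prop :=
  forall p, psi 0 p = p /\ integral_curve X (fun t => psi t p).

Definition jacobian_det {R : realType}
    (F : Cline R * Cline R -> Cline R * Cline R) (p : Cline R * Cline R) :
    R[i] :=
  'D_(1, 0) (fst \o F) p * 'D_(0, 1) (snd \o F) p -
  'D_(0, 1) (fst \o F) p * 'D_(1, 0) (snd \o F) p.

(* The Jacobian determinant is read in a chart of C x P^1 around the image
   point; its vanishing does not depend on the chart. *)
Definition dominating {R : realType}
    (F : Cline R * Cline R -> Cline R * P1 R) : Prop :=
  exists p,
    ((F p).2 <> P1infty /\
       jacobian_det (fun q => ((F q).1, wcoord (F q).2)) p != 0) \/
    ((F p).2 <> P1zero /\
       jacobian_det (fun q => ((F q).1, vcoord (F q).2)) p != 0).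

Definition fiber_preserving {R : realType}
    (F : Cline R * Cline R -> Cline R * P1 R) : Prop :=
  forall p, (F p).1 = p.1.

(* Main.v *)
(* On the fibre over z the field W^u is a Riccati field (A w^2 + B w + G) d/dw
   with A, B, G = e^u a, e^u b, e^u c.  In homogeneous coordinates it is induced
   by the traceless matrix M = [[B/2, G], [-A, -B/2]], whose square is the scalar
   disc = B^2/4 - A G.  Hence its flow is
     exp (t M) = C (disc t^2) + t S (disc t^2) M,
   where C (s) = cosh (sqrt s) and S (s) = sinh (sqrt s) / sqrt s are entire, so
   that the flow is holomorphic jointly in (z, t), also where disc vanishes.
   A curve gam is an integral curve only if exp (- t M) gam (t) is locally
   constant, which identifies psi with this explicit flow.  The quadratic form
   Q = A x^2 + B x y + G y^2 is invariant under exp (t M), and if Q (h) <> 0 then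
   h, M h is a basis in which Q (alpha h + beta M h) is
   (alpha^2 - disc beta^2) Q (h); as exp maps onto the nonzero complex numbers,
   the orbit of h is therefore the whole complement of Q = 0. *)

Require Import Defs.
From HB Require Import structures.
From mathcomp Require Import all_boot all_order all_algebra.
From mathcomp Require Import all_classical all_reals all_analysis.
From mathcomp Require Import complex ring lra.
Set Implicit Arguments.
Unset Strict Implicit.
Unset Printing Implicit Defensive.
Import Order.TTheory GRing.Theory Num.Theory.
Import numFieldNormedType.Exports.
Local Open Scope classical_set_scope.
Local Open Scope ring_scope.

(** * Derivatives over a numeric field *)

Section OneVariable.
Variable K : numFieldType.
Implicit Types (f g : K^o -> K^o) (x d : K^o).

(** Clearing the denominator gives an inequality that holds at [h = 0] as well, so derivatives
    become plain estimates on full neighbourhoods of 0. *)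
Lemma is_deriveP f x d :
  is_derive x 1 f d <->
  forall e : K, 0 < e ->
    \forall h \near (0 : K^o), `|f (h + x) - f x - d * h| <= e * `|h|.
Proof.
split.
- move=> [/derivable_nbhs + <-] e e0; move/eqaddoP => /(_ e e0).
  apply: filterS => h /=; rewrite !fctE opprD addrA.
  by rewrite /GRing.scale/= mulr1 [h * _]mulrC.
- move=> H.
  suff L : (fun h => h^-1 *: ((f \o shift x) (h *: (1 : K^o)) - f x)) @ 0^' --> d.
    by split; [apply/cvg_ex; exists d | exact: cvg_lim].
  apply/cvgrPdist_le => e e0; have := H _ e0.
  rewrite near_withinE; apply: filterS => h He h0.
  have hp : 0 < `|h : K| by rewrite normr_gt0.
  rewrite distrC -(ler_pM2r hp) -normrM.
  by rewrite /GRing.scale/= mulr1 mulrBl [h^-1 * _]mulrC mulfVK.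
Qed.

Lemma is_derive_continuous f x d : is_derive x 1 f d -> {for x, continuous f}.
Proof. by case=> /derivable1_diffP /differentiable_continuous. Qed.

Lemma is_derive_differentiable f x d : is_derive x 1 f d -> differentiable f x.
Proof. by case=> /derivable1_diffP. Qed.

Lemma is_derive_comp f g x df dg :
  is_derive x 1 f df -> is_derive (f x) 1 g dg ->
  is_derive x 1 (g \o f) (dg * df).
Proof.
move=> Hf /is_deriveP Hg; apply/is_deriveP => e e0.
have fc : {for x, continuous f} := is_derive_continuous Hf.
move: Hf => /is_deriveP Hf.
(* The two error terms add up to |dg| + |df| + 1 times the tolerance, |df| + 1 being a Lipschitz
   bound for [f] at [x]; the divisor exceeds that factor. *)
have p0 : 0 < `|dg| + `|df| + 1 + 1 by rewrite ltr_wpDl // !addr_ge0.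
have e'0 : 0 < e / (`|dg| + `|df| + 1 + 1) by rewrite divr_gt0.
have gk : \forall h \near (0 : K^o),
    `|g (f (h + x)) - g (f x) - dg * (f (h + x) - f x)|
    <= e / (`|dg| + `|df| + 1 + 1) * `|f (h + x) - f x|.
  have := Hg _ e'0; rewrite (near_shift (f x)) => H; rewrite (near_shift x).
  have {}H : \forall y \near x, _ := fc _ H.
  by apply: filterS H => h /=; rewrite !sub0r !subrK.
have := Hf _ ltr01; have := Hf _ e'0; move: gk.
set M := (X in e / X); set e1 := e / M.
apply: filterS3 => h A B D.
have kh : `|f (h + x) - f x| <= (`|df| + 1) * `|h|.
  rewrite -[X in `|X|](subrK (df * h)) (le_trans (ler_normD _ _)) //.
  by rewrite mulrDl addrC lerD // normrM.
have -> : g (f (h + x)) - g (f x) - dg * df * h =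
    (g (f (h + x)) - g (f x) - dg * (f (h + x) - f x))
    + dg * (f (h + x) - f x - df * h) by ring.
apply: (le_trans (ler_normD _ _)); rewrite normrM.
apply: (@le_trans _ _ (e1 * ((`|df| + 1) * `|h|) + `|dg| * (e1 * `|h|))).
  by apply: lerD; [apply: (le_trans A); rewrite ler_pM2l|rewrite ler_wpM2l].
have -> : e * `|h| = e1 * M * `|h| by rewrite /e1 divfK ?gt_eqF.
have -> : e1 * ((`|df| + 1) * `|h|) + `|dg| * (e1 * `|h|)
  = e1 * (`|dg| + `|df| + 1) * `|h| by ring.
by rewrite ler_wpM2r // ler_wpM2l ?ltW // ltrDl.
Qed.

End OneVariable.

(** The affine approximation of [f] at [x] also approximates [g], and [diff_unique] identifies its
    linear part with the differential of [g]. *)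
Lemma near_eq_differentiable (K : numFieldType) (V W : normedModType K)
    (f g : V -> W) (x : V) :
  (\forall y \near x, f y = g y) -> differentiable f x -> differentiable g x.
Proof.
move=> fg /diff_locallyP[dfc df].
suff dg : g \o shift x = cst (g x) + 'd f x +o_ 0 id.
  by apply/diff_locallyP; rewrite (diff_unique dfc dg).
apply/eqaddoP => e e0; move/eqaddoP: df => /(_ e e0).
have : \forall h \near (0 : V), f (h + x) = g (h + x).
  rewrite (near_shift x); apply: filterS fg => y /=.
  by rewrite sub0r subrK.
apply: filterS2 => h; rewrite !fctE /= => ->.
by rewrite (nbhs_singleton fg).
Qed.

(** * Analysis on the complex line *)

Section ComplexLine.
Variable R : realType.
Local Notation C := (Cline R).

Lemma normc_ge_Im (z : R[i]) : `|complex.Im z|%:C%C <= `|z|.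
Proof.
by case: z => x y; rewrite normc_def lecR -sqrtr_sqr ler_wsqrtr// lerDr sqr_ge0.
Qed.

Lemma normc_le_sum (z : R[i]) : `|z| <= (`|complex.Re z| + `|complex.Im z|)%:C%C.
Proof.
case: z => x y; rewrite normc_def lecR /= -[leRHS]ger0_norm ?addr_ge0 //.
rewrite -sqrtr_sqr ler_wsqrtr // sqrrD !real_normK ?num_real// lerD2r lerDl.
by rewrite mulrn_wge0 // mulr_ge0.
Qed.

(** The order of [R[i]] compares only numbers with equal imaginary parts, so every positive
    tolerance is real and estimates can be moved to [R]. *)
Lemma posc_real (e : R[i]) : 0 < e -> exists2 r : R, 0 < r & e = r%:C%C.
Proof. by case: e => p q; rewrite ltcE /= => /andP[/eqP -> p0]; exists p. Qed.

Lemma posc_normc (h : C) : exists2 N : R, 0 <= N & `|h : R[i]| = N%:C%C.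
Proof.
exists (Num.sqrt (complex.Re h ^+ 2 + complex.Im h ^+ 2)); first exact: sqrtr_ge0.
exact: normc_def.
Qed.

Lemma near_ballC (P : C -> Prop) (x : C) : (\forall y \near x, P y) ->
  exists2 d : R, 0 < d & forall y : C, `|x - y : R[i]| < d%:C%C -> P y.
Proof.
move=> /nbhs_ballP [_ /posc_real [d d0 ->] H].
by exists d => // y xy; apply: H.
Qed.

Lemma continuous_Re : continuous (@complex.Re R : C -> R^o).
Proof.
move=> z; apply/(@cvgrPdist_le _ _ _ (nbhs (z : C)) (nbhs_filter z)) => e e0.
have e0' : 0 < e%:C%C by rewrite ltcR.
have : \forall w \near z, ball z e%:C%C w by exact: nbhsx_ballx.
apply: filterS => w zw.
have -> : complex.Re z - complex.Re w = complex.Re (z - w : R[i]).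
  by case: z w {zw} => [? ?] [? ?].
by rewrite -lecR (le_trans (normc_ge_Re _)) // ltW.
Qed.

Lemma continuous_Im : continuous (@complex.Im R : C -> R^o).
Proof.
move=> z; apply/(@cvgrPdist_le _ _ _ (nbhs (z : C)) (nbhs_filter z)) => e e0.
have e0' : 0 < e%:C%C by rewrite ltcR.
have : \forall w \near z, ball z e%:C%C w by exact: nbhsx_ballx.
apply: filterS => w zw.
have -> : complex.Im z - complex.Im w = complex.Im (z - w : R[i]).
  by case: z w {zw} => [? ?] [? ?].
by rewrite -lecR (le_trans (normc_ge_Im _)) // ltW.
Qed.

Lemma near_neq (z a : C) : z != a -> \forall w \near z, w != a.
Proof.
move=> za; have /open_nbhs_nbhs : open_nbhs z (~` [set a]).
  split; last exact/eqP.
  rewrite openC; apply: accessible_closed_set1; apply: hausdorff_accessible.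
  exact: norm_hausdorff.
by apply: filterS => w /eqP.
Qed.

Lemma near_neqV (V : normedModType R[i]) (f : V -> C) (x : V) :
  {for x, continuous f} -> f x != 0 -> \forall y \near x, f y != 0.
Proof. by move=> fc fx; exact: fc _ (near_neq fx). Qed.

(* The library versions, in the pointwise form needed below: unifying R[i] with
   its regular module R[i]^o when applying them directly may diverge. *)
Lemma continuous_mul (f g : C -> C) (x : C) : {for x, continuous f} ->
  {for x, continuous g} -> {for x, continuous (fun y => f y * g y)}.
Proof. exact: continuousM. Qed.

Lemma differentiable_invr (y : C) : y != 0 -> differentiable (fun w : C => w^-1) y.
Proof. exact: differentiable_Rinv. Qed.

Lemma differentiable_inv (V : normedModType R[i]) (f : V -> C) (x : V) :
  differentiable f x -> f x != 0 -> differentiable (fun y => (f y)^-1) x.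
Proof. by move=> df f0; apply: differentiableV. Qed.

Lemma differentiable_add (V : normedModType R[i]) (f g : V -> C) (x : V) :
  differentiable f x -> differentiable g x -> differentiable (fun y => f y + g y) x.
Proof. exact: differentiableD. Qed.

Lemma differentiable_sub (V : normedModType R[i]) (f g : V -> C) (x : V) :
  differentiable f x -> differentiable g x -> differentiable (fun y => f y - g y) x.
Proof. exact: differentiableB. Qed.

Lemma differentiable_mul (V : normedModType R[i]) (f g : V -> C) (x : V) :
  differentiable f x -> differentiable g x -> differentiable (fun y => f y * g y) x.
Proof. exact: differentiableM. Qed.

Lemma differentiable_const (V : normedModType R[i]) (k : C) (x : V) :
  differentiable (fun _ : V => k) x.
Proof. exact: differentiable_cst. Qed.

Lemma differentiable_fst (V V' : normedModType R[i]) (q : V * V') :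
  differentiable (fst : V * V' -> V) q.
Proof. by apply: linear_differentiable => p; exact: cvg_fst. Qed.

Lemma differentiable_snd (V V' : normedModType R[i]) (q : V * V') :
  differentiable (snd : V * V' -> V') q.
Proof. by apply: linear_differentiable => p; exact: cvg_snd. Qed.

Lemma is_derive_add (f g : C -> C) (t df dg : C) :
  is_derive t 1 f df -> is_derive t 1 g dg ->
  is_derive t 1 (fun s => f s + g s) (df + dg).
Proof. by move=> hf hg; exact: is_deriveD. Qed.

Lemma is_derive_sub (f g : C -> C) (t df dg : C) :
  is_derive t 1 f df -> is_derive t 1 g dg ->
  is_derive t 1 (fun s => f s - g s) (df - dg).
Proof. by move=> hf hg; exact: is_deriveB. Qed.

Lemma is_derive_mul (f g : C -> C) (t df dg : C) :
  is_derive t 1 f df -> is_derive t 1 g dg ->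
  is_derive t 1 (fun s => f s * g s) (df * g t + f t * dg).
Proof.
move=> hf hg; have := is_deriveM hf hg.
congr (is_derive _ _ _ _); rewrite addrC; congr (_ + _); exact: mulrC.
Qed.

Lemma is_derive_const (k t : C) : is_derive t 1 (fun _ : C => k) 0.
Proof. exact: is_derive_cst. Qed.

Lemma is_derive_idC (t : C) : is_derive t 1 (fun s : C => s) 1.
Proof. exact: is_derive_id. Qed.

Lemma is_derive_scale (k t : C) : is_derive t 1 (fun s : C => k * s) k.
Proof.
have := is_derive_mul (is_derive_const k t) (is_derive_idC t).
by rewrite mul0r add0r mulr1.
Qed.

Lemma is_derive_opp (t : C) : is_derive t 1 (fun s : C => - s) (- 1).
Proof. exact: is_deriveNid. Qed.

Lemma is_derive_div (f g : C -> C) (t df dg : C) : g t != 0 ->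
  is_derive t 1 f df -> is_derive t 1 g dg ->
  is_derive t 1 (fun s => f s / g s) ((df * g t - f t * dg) / g t ^+ 2).
Proof.
move=> g0 hf hg.
have hV : is_derive t 1 (fun s => (g s)^-1) (- (g t ^- 2) * dg).
  case: hg => dg' <-; split; first exact: derivableV.
  exact: deriveV.
have := is_derive_mul hf hV; congr (is_derive _ _ _ _).
move: (df : R[i]) (dg : R[i]) (f t : R[i]) (g t : R[i]) g0 => x y z w w0.
by field.
Qed.

(** Reduces the partial derivatives in the Jacobian to derivatives in one complex variable. *)
Lemma derive_line (V W : normedModType R[i]) (f : V -> W) (p v : V) :
  'D_v f p = 'D_1 (fun h : C => f (h *: v + p)) 0.
Proof.
rewrite /derive; set g1 := (fun h => h^-1 *: _); set g2 := (fun h => h^-1 *: _).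
suff -> : g1 = g2 by [].
by rewrite funeqE /g1 /g2 => h /=; rewrite addr0 scale0r add0r [_%:A]mulr1.
Qed.

Lemma derive_fst (v p : C * C) : 'D_v (fst : C * C -> C) p = v.1.
Proof.
rewrite derive_line.
have := is_derive_add (is_derive_mul (is_derive_idC 0) (is_derive_const v.1 0))
                      (is_derive_const p.1 0).
by rewrite mul1r mulr0 !addr0; case.
Qed.

(** Carathéodory's criterion. It serves where the difference quotient has a closed form that is
    visibly continuous, as for square roots and [coshroot]. *)
Lemma is_derive_caratheodory (f k : C -> C) x :
  (forall y, f y - f x = (y - x) * k y) -> {for x, continuous k} ->
  is_derive x 1 f (k x).
Proof.
move=> fk kc; apply/is_deriveP => e e0.
have H : \forall y \near x, `|k y - k x| <= e.
  move/(@cvgrPdist_le _ _ _ (nbhs (x : C)) (nbhs_filter x)): kc => /(_ e e0).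
  by apply: filterS => y; rewrite distrC.
rewrite (near_shift x); apply: filterS H => y /=.
rewrite sub0r subrK fk => yk.
by rewrite [k x * _]mulrC -mulrBr normrM mulrC ler_wpM2r.
Qed.

(** Meant for [p] the real or imaginary part: it brings a vanishing complex derivative down to a
    real function on a segment, where the real mean value theorem applies. *)
Lemma is_derive_segment (p : R[i] -> R) (f : C -> C) (t h : C) (s : R) :
  (forall z w, p (z - w) = p z - p w) -> (forall z, `|p z|%:C%C <= `|z|) ->
  is_derive (t + s%:C%C * h) 1 f 0 ->
  is_derive (s : R^o) 1 (fun r : R^o => p (f (t + r%:C%C * h)) : R^o) 0.
Proof.
move=> pB pn /is_deriveP H; apply/is_deriveP => e e0.
have [N N0 EN] := posc_normc h.
(* [N + 1] replaces [N] as divisor because [h] may be 0. *)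
have N1 : 0 < N + 1 by rewrite ltr_wpDl.
have e'0 : 0 < (e / (N + 1))%:C%C by rewrite ltcR divr_gt0.
have /near_ballC [d d0 Hd] := H _ e'0.
have : \forall k \near (0 : R^o), ball (0 : R^o) (d / (N + 1)) k.
  by apply: nbhsx_ballx; rewrite divr_gt0.
apply: filterS => k; rewrite -ball_normE /= sub0r normrN => kd.
have nkh : `|k%:C%C * h : R[i]| = (`|k| * N)%:C%C.
  by rewrite normrM EN rmorphM normc_def /= expr0n addr0 sqrtr_sqr.
have := Hd (k%:C%C * h); rewrite sub0r normrN nkh ltcR mul0r subr0.
have -> : (k%:C%C * h : C) + (t + s%:C%C * h) = t + (k + s)%:C%C * h.
  by rewrite rmorphD mulrDl addrCA.
move=> Hk; have {}Hk := Hk _.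
rewrite mul0r subr0 -pB.
have kN : `|k| * N < d.
  move: kd; rewrite ltr_pdivlMr // => /(le_lt_trans _); apply.
  by rewrite ler_wpM2l // lerDl.
move/(_ kN): Hk => Hk.
rewrite -lecR (le_trans (pn _)) // (le_trans Hk) // -rmorphM lecR.
by rewrite -mulrA ler_pM2l // mulrC ler_pdivrMr // ler_wpM2l // lerDl ler01.
Qed.

(** A ball is star-shaped about its centre: the mean value theorem on the segment from [t0] to [t]
    is applied to the real and imaginary parts separately. *)
Lemma derive0_near_cst (f : C -> C) (t0 : C) :
  (\forall t \near t0, is_derive (t : C) 1 f 0) -> \forall t \near t0, f t = f t0.
Proof.
move=> /near_ballC [d d0 H].
have d0' : 0 < d%:C%C by rewrite ltcR.
have : \forall t \near t0, ball t0 d%:C%C t by exact: nbhsx_ballx.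
apply: filterS => t; rewrite -ball_normE /= => td.
have inball s : s \in `[(0 : R), 1] -> is_derive (t0 + s%:C%C * (t - t0)) 1 f 0.
  rewrite in_itv /= => /andP[s0 s1]; apply: H.
  rewrite opprD addNKr normrN normrM distrC.
  apply: le_lt_trans td; rewrite ger0_norm ?ler0c // ler_piMl //.
  by rewrite lecR.
have cstp (p : R[i] -> R) : (forall z w, p (z - w) = p z - p w) ->
    (forall z, `|p z|%:C%C <= `|z|) -> p (f t) = p (f t0).
  move=> pB pn.
  pose phi (r : R) := p (f (t0 + r%:C%C * (t - t0))).
  have dphi s : s \in `[(0 : R), 1] -> is_derive s 1 phi 0.
    by move=> /inball; exact: is_derive_segment.
  have h1 x : x \in `](0 : R), 1[ -> is_derive x 1 phi ((fun=> 0) x).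
    by move=> x01; apply: dphi; apply: subset_itv_oo_cc x01.
  have h2 : {within `[(0 : R), 1], continuous phi}.
    by apply: derivable_within_continuous => x /dphi [].
  have [c _] := @MVT R phi (fun=> 0) 0 1 ltr01 h1 h2.
  rewrite mul0r /phi rmorph0 rmorph1 mul0r mul1r addr0 subrKC => /eqP.
  by rewrite subr_eq0 => /eqP.
have hr := cstp (@complex.Re R) _ (@normc_ge_Re R).
have hi := cstp (@complex.Im R) _ normc_ge_Im.
apply/eqP; rewrite eq_complex; apply/andP; split; apply/eqP.
- by apply: hr => -[? ?] [? ?].
- by apply: hi => -[? ?] [? ?].
Qed.

(* Along the segment from 0 to t, the indicator of eta = eta 0 has zero
   derivative. *)
Lemma locally_cst (T : Type) (eta : C -> T) :
  (forall t, \forall s \near t, eta s = eta t) -> forall t, eta t = eta 0.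
Proof.
move=> loc t.
pose chi (r : R^o) : R^o := `[< eta (r%:C%C * t) = eta 0 >]%:R.
have dchi x : is_derive (x : R^o) 1 chi 0.
  have cx : {for x, continuous (fun r : R^o => r%:C%C * t : C)}.
    apply/(@cvgrPdist_le _ _ _ (nbhs (x : R^o)) (nbhs_filter _)) => _ /posc_real [e e0 ->].
    have [N N0 EN] := posc_normc t.
    have N1 : 0 < N + 1 by rewrite ltr_wpDl.
    have : \forall k \near x, ball (x : R^o) (e / (N + 1)) k.
      by apply: nbhsx_ballx; rewrite divr_gt0.
    apply: filterS => y; rewrite -ball_normE /= ltr_pdivlMr // => xy.
    rewrite -mulrBl normrM EN -rmorphB normc_def /= expr0n addr0 sqrtr_sqr -rmorphM lecR.
    by rewrite (le_trans _ (ltW xy)) // ler_wpM2l // lerDl.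
  have near_x : \forall y \near x, eta (y%:C%C * t) = eta (x%:C%C * t).
    exact: cx _ (loc (x%:C%C * t)).
  apply: (@near_eq_is_derive R R^o R^o (cst (chi x)) chi x 1 0).
  by apply: filterS near_x => y /= e; rewrite /chi e.
have := is_derive_0_is_cst 1 0 dchi.
rewrite /chi rmorph1 rmorph0 mul1r mul0r.
rewrite (asboolT (erefl (eta 0))) => /eqP.
by case: asboolP => // _; rewrite eq_sym oner_eq0.
Qed.

End ComplexLine.

(** * The complex exponential *)

Section ComplexExponential.
Variable R : realType.
Local Notation C := (Cline R).

Lemma cexpD (z w : C) : cexp (z + w) = cexp z * cexp w.
Proof.
case: z w => [x y] [x' y'].
rewrite /cexp /= expRD cosD sinD; apply/eqP; rewrite eq_complex /=.
by apply/andP; split; apply/eqP; ring.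
Qed.

Lemma cexp0 : cexp (0 : C) = 1.
Proof. by rewrite /cexp /= expR0 cos0 sin0 mulr0 mulr1. Qed.

Lemma cexpVN (z : C) : cexp z * cexp (- z) = 1.
Proof. by rewrite -cexpD subrr cexp0. Qed.

Lemma cexp_neq0 (z : C) : cexp z != 0.
Proof.
apply/eqP => z0; have := cexpVN z; rewrite z0 mul0r => /esym/eqP.
by rewrite oner_eq0.
Qed.

Lemma is_derive_cexp0 : is_derive (0 : C) 1 cexp 1.
Proof.
apply/is_deriveP => _ /posc_real [e e0 ->].
(* Near 0 one has [expR x <= 2], so the real and the imaginary part of the error each cost at most 2
   + 1 tolerances; hence the sixth. *)
have e6 : 0 < e / 6 by rewrite divr_gt0.
have /is_deriveP/(_ _ e6) hE : is_derive (0 : R^o) 1 (expR : R^o -> R^o) 1.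
  by have := is_derive_expR (0 : R); rewrite expR0.
have /is_deriveP/(_ _ e6) hC : is_derive (0 : R^o) 1 (cos : R^o -> R^o) 0.
  by have := is_derive_cos (0 : R); rewrite sin0 oppr0.
have /is_deriveP/(_ _ e6) hS : is_derive (0 : R^o) 1 (sin : R^o -> R^o) 1.
  by have := is_derive_sin (0 : R); rewrite cos0.
have hE' : \forall h \near (0 : R^o), `|expR h - 1| <= Num.min 1 (e / 6).
  have : expR @ (0 : R) --> expR (0 : R) by exact: continuous_expR.
  rewrite expR0 => /cvgrPdist_le.
  move=> /(_ (Num.min 1 (e / 6))); rewrite lt_min ltr01 e6 => /(_ isT).
  by apply: filterS => h; rewrite distrC.
near=> h.
have x1 : `|expR (complex.Re h + 0) - expR 0 - 1 * complex.Re h|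
    <= e / 6 * `|complex.Re h|.
  by near: h; exact: (continuous_Re (x := 0) hE).
have x2 : `|expR (complex.Re h) - 1| <= Num.min 1 (e / 6).
  by near: h; exact: (continuous_Re (x := 0) hE').
have y1 : `|cos (complex.Im h + 0) - cos 0 - 0 * complex.Im h|
    <= e / 6 * `|complex.Im h|.
  by near: h; exact: (continuous_Im (x := 0) hC).
have y2 : `|sin (complex.Im h + 0) - sin 0 - 1 * complex.Im h|
    <= e / 6 * `|complex.Im h|.
  by near: h; exact: (continuous_Im (x := 0) hS).
have hR := normc_ge_Re h; have hI := normc_ge_Im h.
rewrite addr0 cexp0 mul1r.
apply: (le_trans (normc_le_sum _)).
have -> : complex.Re (cexp h - 1 - h : R[i])
    = expR (complex.Re h) * cos (complex.Im h) - 1 - complex.Re h.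
  by case: (h).
have -> : complex.Im (cexp h - 1 - h : R[i])
    = expR (complex.Re h) * sin (complex.Im h) - 0 - complex.Im h.
  by case: (h).
move: x1 x2 y1 y2 hR hI.
move: (complex.Re h) (complex.Im h) => x y.
rewrite normc_def /= -rmorphM !lecR !addr0 !mul1r mul0r subr0 expR0 cos0 sin0 subr0.
set N := Num.sqrt _.
rewrite le_min => x1 /andP[x2 x2'] y1 y2 hx hy.
have -> : expR x * cos y - 1 - x
    = expR x * (cos y - 1) + (expR x - 1 - x) by ring.
have -> : expR x * sin y - 0 - y
    = expR x * (sin y - y) + (expR x - 1) * y by ring.
have ex2 : `|expR x| <= 2.
  by rewrite -[expR x](subrK 1) (le_trans (ler_normD _ _)) // normr1; lra.
have A1 : `|expR x * (cos y - 1)| <= 2 * (e / 6 * `|y|).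
  by rewrite normrM ler_pM.
have A2 : `|expR x * (sin y - y)| <= 2 * (e / 6 * `|y|).
  by rewrite normrM ler_pM.
have A3 : `|(expR x - 1) * y| <= e / 6 * `|y| by rewrite normrM ler_wpM2r.
have A4 := ler_normD (expR x * (cos y - 1)) (expR x - 1 - x).
have A5 := ler_normD (expR x * (sin y - y)) ((expR x - 1) * y).
have A6 : e / 6 * `|y| <= e / 6 * N by rewrite ler_pM2l.
have A7 : e / 6 * `|x| <= e / 6 * N by rewrite ler_pM2l.
by lra.
Unshelve. all: by end_near. Qed.

Lemma is_derive_cexp (z : C) : is_derive z 1 cexp (cexp z).
Proof.
have /is_deriveP H := is_derive_cexp0.
apply/is_deriveP => e e0.
have z0 : 0 < `|cexp z| by rewrite normr_gt0 cexp_neq0.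
have := H (e / `|cexp z|) (divr_gt0 e0 z0).
apply: filterS => h; rewrite addr0 cexp0 mul1r => Hh.
have -> : cexp (h + z) - cexp z - cexp z * h = (cexp h - 1 - h) * cexp z.
  by rewrite cexpD; ring.
by rewrite normrM (le_trans (ler_wpM2r (ltW z0) Hh)) // mulrAC mulfVK ?gt_eqF.
Qed.

Lemma cexp_surj (w : C) : w != 0 -> exists z : C, cexp z = w.
Proof.
case: w => p q w0.
pose r := Num.sqrt (p ^+ 2 + q ^+ 2).
have r2 : r ^+ 2 = p ^+ 2 + q ^+ 2 by rewrite sqr_sqrtr // addr_ge0 ?sqr_ge0.
have r0 : 0 < r.
  rewrite sqrtr_gt0 lt_neqAle addr_ge0 ?sqr_ge0 // andbT eq_sym.
  rewrite paddr_eq0 ?sqr_ge0 // !sqrf_eq0.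
  by apply: contra w0 => /andP[/eqP-> /eqP->].
have le1 : -1 <= p / r <= 1.
  rewrite -ler_norml normrM normfV (gtr0_norm r0) ler_pdivrMr // mul1r.
  by rewrite -sqrtr_sqr ler_wsqrtr // lerDl sqr_ge0.
have qr : 1 - (p / r) ^+ 2 = (q / r) ^+ 2.
  rewrite !exprMn exprVn -[1](@mulfV _ (r ^+ 2)) ?expf_neq0 ?gt_eqF // -mulrBl.
  by rewrite r2 addrC addKr.
(* [acos] only reaches the upper half circle; the sign of [q] selects the half. *)
pose th := if 0 <= q then acos (p / r) else - acos (p / r).
have [cth sth] : cos th = p / r /\ sin th = q / r.
  rewrite /th; case: ifPn => [q0|]; last rewrite -ltNge => q0.
    by rewrite acosK // sin_acos // qr sqrtr_sqr ger0_norm // divr_ge0 // ltW.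
  rewrite cosN sinN acosK // sin_acos // qr sqrtr_sqr.
  by rewrite normrM normfV (gtr0_norm r0) (ltr0_norm q0) mulNr opprK.
exists (Complex (ln r) th); rewrite /cexp /= lnK ?posrE // cth sth.
by rewrite ![r * _]mulrC !mulfVK ?gt_eqF.
Qed.

End ComplexExponential.

(** * The entire functions cosh (sqrt s) and sinh (sqrt s) / sqrt s *)

Section HyperbolicRoots.
Variable R : realType.
Local Notation C := (Cline R).

Definition coshc (z : C) : C := (cexp z + cexp (- z)) / 2.
Definition sinhc (z : C) : C := (cexp z - cexp (- z)) / 2.
Definition sinhq (z : C) : C := if z == 0 then 1 else sinhc z / z.
(* coshc and sinhq are even, so the choice of the square root is irrelevant. *)
Definition coshroot (s : C) : C := coshc (sqrtc s).
Definition sinhroot (s : C) : C := sinhq (sqrtc s).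

Lemma coshcN z : coshc (- z) = coshc z.
Proof. by rewrite /coshc opprK addrC. Qed.

Lemma coshc0 : coshc 0 = 1 :> C.
Proof. by rewrite /coshc oppr0 cexp0 divff // pnatr_eq0. Qed.

Lemma sinhqN z : sinhq (- z) = sinhq z.
Proof.
rewrite /sinhq oppr_eq0; case: ifP => // _.
by rewrite /sinhc opprK invrN mulrN -mulNr -mulNr opprB.
Qed.

Lemma sinhqE z : sinhc z = z * sinhq z.
Proof.
rewrite /sinhq; case: eqP => [->|/eqP z0]; last by rewrite mulrCA mulfV ?mulr1.
by rewrite /sinhc oppr0 subrr !mul0r.
Qed.

Lemma sinhq0 : sinhq 0 = 1.
Proof. by rewrite /sinhq eqxx. Qed.

Lemma sqrtc_sqr (r : C) : sqrtc (r ^+ 2) = r \/ sqrtc (r ^+ 2) = - r.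
Proof.
by have /eqP := sqr_sqrtc (r ^+ 2 : R[i]); rewrite eqf_sqr => /orP[]/eqP; [left|right].
Qed.

Lemma coshroot_sqr r : coshroot (r ^+ 2) = coshc r.
Proof. by rewrite /coshroot; case: (sqrtc_sqr r) => ->; rewrite ?coshcN. Qed.

Lemma sinhroot_sqr r : sinhroot (r ^+ 2) = sinhq r.
Proof. by rewrite /sinhroot; case: (sqrtc_sqr r) => ->; rewrite ?sinhqN. Qed.

Lemma cosh_sinh_sqr z : coshc z ^+ 2 - sinhc z ^+ 2 = 1.
Proof.
rewrite -(cexpVN z) /coshc /sinhc.
by move: (cexp z : R[i]) (cexp (- z) : R[i]) => p q; field.
Qed.

(** This is cosh^2 - sinh^2 = 1 at a square root of [s]; it will say that exp (t M) has determinant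
    1. *)
Lemma coshroot_sinhroot s : coshroot s ^+ 2 - s * sinhroot s ^+ 2 = 1.
Proof.
rewrite -[s](sqr_sqrtc (s : R[i])) coshroot_sqr sinhroot_sqr -(cosh_sinh_sqr (sqrtc s)).
by rewrite sinhqE [(_ * sinhq _) ^+ 2]exprMn.
Qed.

(** Factors differences of cosh, which yields the difference quotient of [coshroot]. *)
Lemma coshcB x y : coshc (x + y) - coshc (x - y) = 2 * sinhc x * sinhc y.
Proof.
rewrite /coshc /sinhc !opprD !opprK !cexpD.
by move: (cexp x : R[i]) (cexp (- x) : R[i]) (cexp y : R[i]) (cexp (- y) : R[i])
  => p q r s; field.
Qed.

Lemma sinhc_double z : sinhc (z + z) = 2 * sinhc z * coshc z.
Proof.
rewrite /coshc /sinhc !opprD !cexpD.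
by move: (cexp z : R[i]) (cexp (- z) : R[i]) => p q; field.
Qed.

(** The duplication formula of sinh: doubling a square root of [s] multiplies [s] by 4. *)
Lemma sinhroot_quadruple s : sinhroot (4 * s) = sinhroot s * coshroot s.
Proof.
rewrite -[s](sqr_sqrtc (s : R[i])); set r := sqrtc s.
have -> : 4 * r ^+ 2 = (r + r) ^+ 2 by ring.
rewrite !sinhroot_sqr coshroot_sqr.
have [->|r0] := eqVneq r 0.
  by rewrite addr0 sinhq0 coshc0 mul1r.
have rr0 : r + r != 0 by rewrite -mulr2n mulrn_eq0.
apply: (@mulfI R[i] _ rr0); rewrite -sinhqE sinhc_double sinhqE.
by ring.
Qed.

Lemma is_derive_cexpN (z : C) : is_derive z 1 (fun z : C => cexp (- z)) (- cexp (- z)).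
Proof.
have := is_derive_comp (is_derive_opp z) (is_derive_cexp (- z)); rewrite mulrN1.
by apply.
Qed.

Lemma is_derive_coshc (z : C) : is_derive z 1 coshc (sinhc z).
Proof.
have h1 := is_derive_cexp z; have h2 := is_derive_cexpN z.
have := is_deriveZ 2^-1 (is_deriveD h1 h2).
congr (is_derive _ _ _ _); [apply/funext => w|]; rewrite /coshc /sinhc; exact: mulrC.
Qed.

Lemma is_derive_sinhc (z : C) : is_derive z 1 sinhc (coshc z).
Proof.
have h1 := is_derive_cexp z; have h2 := is_derive_cexpN z.
have := is_deriveZ 2^-1 (is_deriveB h1 h2).
congr (is_derive _ _ _ _); [apply/funext => w|]; rewrite /coshc /sinhc.
  exact: mulrC.
by rewrite opprK; exact: mulrC.
Qed.

(** At 0 the claim amounts to sinh having derivative [coshc 0 = 1] there; elsewhere [sinhq] is a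
    quotient. *)
Lemma continuous_sinhq : continuous sinhq.
Proof.
move=> z; have [->|z0] := eqVneq z 0; last first.
  have h : {for z, continuous (fun w : C => sinhc w / w)}.
    apply: continuousM; first exact: is_derive_continuous (is_derive_sinhc z).
    by apply: continuousV => //; exact: cvg_id.
  have e : \near z, sinhc z / z = sinhq z.
    by apply: filterS (near_neq z0) => w w0; rewrite /sinhq (negbTE w0).
  rewrite /prop_for /continuous_at -(nbhs_singleton e).
  exact: cvg_trans (near_eq_cvg e) h.
rewrite /continuous_at sinhq0.
have /is_deriveP H := is_derive_sinhc 0.
apply/(@cvgrPdist_le _ _ _ (nbhs (0 : C)) (nbhs_filter (0 : C))) => e e0.
apply: filterS (H _ e0) => h.
rewrite addr0 /sinhq; case: eqP => [_ _|/eqP h0]; first by rewrite subrr normr0 ltW.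
have -> : sinhc 0 = 0 by rewrite sinhqE mul0r.
rewrite coshc0 subr0 mul1r => hh.
have hp : 0 < `|h : R[i]| by rewrite normr_gt0.
by rewrite distrC -(ler_pM2r hp) -normrM mulrBl mul1r divfK.
Qed.

(* The square root of s nearest to r0; unlike sqrtc it is always continuous
   at r0 ^+ 2. *)
Definition sqrt_near (r0 s : C) : C :=
  if `|sqrtc s - r0 : R[i]| <= `|sqrtc s + r0 : R[i]| then sqrtc s else - sqrtc s.

Lemma sqrt_nearK r0 s : sqrt_near r0 s ^+ 2 = s.
Proof. by rewrite /sqrt_near; case: ifP; rewrite ?sqrrN sqr_sqrtc. Qed.

Lemma sqrt_near_le r0 s :
  `|sqrt_near r0 s - r0 : R[i]| <= `|sqrt_near r0 s + r0 : R[i]|.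
Proof.
rewrite /sqrt_near; case: ifPn => //.
rewrite -real_ltNge ?normr_real // => /ltW.
by rewrite -opprD normrN -[_ - r0]opprB normrN [r0 - _]addrC.
Qed.

Lemma sqrt_near_subr r0 s :
  s - r0 ^+ 2 = (sqrt_near r0 s - r0) * (sqrt_near r0 s + r0).
Proof. by rewrite -subr_sqr sqrt_nearK. Qed.

(** [s - r0 ^+ 2] is the product of the differences of the chosen root with [r0] and with [- r0],
    and the first factor is the smaller one. *)
Lemma sqrt_near_dist r0 s : `|sqrt_near r0 s - r0 : R[i]| ^+ 2 <= `|s - r0 ^+ 2 : R[i]|.
Proof.
by rewrite sqrt_near_subr expr2 normrM ler_wpM2l // sqrt_near_le.
Qed.

Lemma sqrt_near_id r0 : sqrt_near r0 (r0 ^+ 2) = r0.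
Proof.
apply/eqP; rewrite -subr_eq0 -normr_eq0 -sqrf_eq0 eq_le exprn_ge0 // andbT.
by rewrite (le_trans (sqrt_near_dist _ _)) // subrr normr0.
Qed.

Lemma continuous_sqrt_near r0 : {for r0 ^+ 2, continuous (sqrt_near r0)}.
Proof.
apply/(@cvgrPdist_lt _ _ _ (nbhs (r0 ^+ 2 : C)) (nbhs_filter _)) => e e0.
have : \forall s \near r0 ^+ 2, ball (r0 ^+ 2) (e ^+ 2) s.
  by apply: nbhsx_ballx; rewrite exprn_gt0.
apply: filterS => s rs; rewrite sqrt_near_id distrC.
rewrite -(ltr_pXn2r (n := 2)) ?nnegrE ?(ltW e0) //.
by rewrite (le_lt_trans (sqrt_near_dist _ _)) // distrC.
Qed.

(** As [sinhq] is even, the discontinuous [sqrtc] may be replaced by the root nearest to [r0], which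
    is continuous at the point considered. *)
Lemma continuous_sinhroot : continuous sinhroot.
Proof.
move=> s; rewrite -[s](sqr_sqrtc (s : R[i])); set r0 := sqrtc s.
have -> : sinhroot = sinhq \o sqrt_near r0.
  by apply/funext => x; rewrite /= -[in LHS](sqrt_nearK r0 x) sinhroot_sqr.
apply: continuous_comp; first exact: continuous_sqrt_near.
exact: continuous_sinhq.
Qed.

(** With r the root of x nearest to [r0], cosh r - cosh r0 = 2 sinh ((r + r0) / 2) sinh ((r - r0) /
    2) = (x - r0^2) [k x]. The factor [k] is continuous even for [r0 = 0], so the branch point needs
    no separate treatment. *)
Lemma is_derive_coshroot (s : C) : is_derive s 1 coshroot (sinhroot s / 2).
Proof.
rewrite -[s](sqr_sqrtc (s : R[i])); move: (sqrtc s : C) => {s} r0.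
pose k x : C :=
  sinhq ((sqrt_near r0 x + r0) / 2) * sinhq ((sqrt_near r0 x - r0) / 2) / 2.
have -> : sinhroot (r0 ^+ 2) / 2 = k (r0 ^+ 2).
  rewrite /k sqrt_near_id subrr mul0r sinhq0 mulr1 sinhroot_sqr.
  by congr (sinhq _ / 2); move: (r0 : R[i]) => x; field.
apply: is_derive_caratheodory => [x|].
  have h := coshcB ((sqrt_near r0 x + r0) / 2) ((sqrt_near r0 x - r0) / 2).
  rewrite -[in LHS](sqrt_nearK r0 x) !coshroot_sqr sqrt_near_subr /k.
  move: h; rewrite !sinhqE.
  set p := sinhq _; set q := sinhq _; move: (sqrt_near r0 x) p q => {}x p q.
  have -> : (x + r0) / 2 + (x - r0) / 2 = x by move: (x : R[i]) => {}x; field.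
  have -> : (x + r0) / 2 - (x - r0) / 2 = r0 by move: (x : R[i]) => {}x; field.
  by move=> ->; move: (x : R[i]) (p : R[i]) (q : R[i]) => {}x {}p {}q; field.
have hr : {for r0 ^+ 2, continuous (sqrt_near r0)} := @continuous_sqrt_near r0.
have hc : {for r0 ^+ 2, continuous (fun _ : C => r0 : C)} by exact: cst_continuous.
have h2 : {for r0 ^+ 2, continuous (fun _ : C => 2^-1 : C)} by exact: cst_continuous.
have hA : {for r0 ^+ 2, continuous (fun x => sinhq ((sqrt_near r0 x + r0) / 2))}.
  apply: (@continuous_comp _ _ _ (fun x => (sqrt_near r0 x + r0) / 2) sinhq).
    exact: (continuousM (continuousD hr hc) h2).
  exact: continuous_sinhq.
have hB : {for r0 ^+ 2, continuous (fun x => sinhq ((sqrt_near r0 x - r0) / 2))}.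
  apply: (@continuous_comp _ _ _ (fun x => (sqrt_near r0 x - r0) / 2) sinhq).
    exact: (continuousM (continuousB hr hc) h2).
  exact: continuous_sinhq.
exact: continuous_mul (continuous_mul hA hB) h2.
Qed.

(** The nearest root r has difference quotient 1 / (r + r0), continuous as long as [r0] is nonzero.
    This breaks down at [s = 0], which is handled by [is_derive_sinhroot0]. *)
Lemma differentiable_sinhroot_neq0 (s : C) : s != 0 -> differentiable sinhroot s.
Proof.
move=> s0; have : sqrtc (s : R[i]) != 0 by rewrite sqrtc_eq0.
rewrite -[in differentiable _ _](sqr_sqrtc (s : R[i])).
move: (sqrtc s : C) => {s s0} r0 r00.
(* If the nearest root were [- r0], its distance to [r0] would be at most 0, forcing [r0 = 0]. *)
have rD x : sqrt_near r0 x + r0 != 0.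
  apply/eqP => h; have := sqrt_near_le r0 x; rewrite h normr0 normr_le0 subr_eq0.
  move=> /eqP xr; move: h; rewrite xr => /eqP.
  by rewrite -mulr2n mulrn_eq0 (negbTE r00).
have rn0 : sqrt_near r0 (r0 ^+ 2) != 0 by rewrite sqrt_near_id.
have dr : differentiable (sqrt_near r0) (r0 ^+ 2).
  apply: is_derive_differentiable.
  apply: (@is_derive_caratheodory _ _ (fun x => (sqrt_near r0 x + r0)^-1)) => [x|].
    by rewrite sqrt_near_id sqrt_near_subr mulfK.
  apply: continuousV; first exact: rD.
  by apply: continuousD; [exact: continuous_sqrt_near | exact: cst_continuous].
have -> : sinhroot = sinhq \o sqrt_near r0.
  by apply/funext => x; rewrite /= -[in LHS](sqrt_nearK r0 x) sinhroot_sqr.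
apply: differentiable_comp; first exact: dr.
move: (sqrt_near r0 (r0 ^+ 2)) rn0 => y y0.
apply/derivable1_diffP; apply: (@near_eq_derivable _ _ _ (fun w : C => sinhc w / w)).
  have : \forall w \near y, w != 0 by exact: near_neq.
  by apply: filterS => w w0; rewrite /sinhq (negbTE w0).
apply/derivable1_diffP; apply: differentiableM.
  exact: is_derive_differentiable (is_derive_sinhc _).
exact: differentiable_invr.
Qed.

(* Sum the hypothesis over s / 4, s / 4 ^ 2, ...: the increments telescope and
   F (s / 4 ^ n) tends to F 0 = 0. *)
Lemma quadruple_bound (F : C -> C) (e : R[i]) :
  {for 0, continuous F} -> F 0 = 0 ->
  0 <= e ->
  (\forall s \near (0 : C), `|F (4 * s) - F s : R[i]| <= e * `|s : R[i]|) ->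
  \forall s \near (0 : C), `|F s : R[i]| <= e * `|s : R[i]|.
Proof.
move=> F0c F0 e0 /near_ballC [d d0 H].
have d0' : 0 < d%:C%C by rewrite ltcR.
have : \forall s \near (0 : C), ball (0 : C) d%:C%C s by exact: nbhsx_ballx.
apply: filterS => s; rewrite -ball_normE /= => sd.
pose v n : C := 4^-1 ^+ n * s.
have q0 : 0 <= 4^-1 :> R[i] by rewrite invr_ge0 ler0n.
have nv n : `|v n : R[i]| = 4^-1 ^+ n * `|s : R[i]|.
  by rewrite /v normrM ger0_norm // exprn_ge0.
have q1 n : (4^-1 : R[i]) ^+ n <= 1.
  by rewrite exprn_ile1 // invf_le1 ?ltr0n // ler1n.
(* The increments contribute e |s| times the sum of 4^-k for 1 <= k <= n; the cruder factor 1 - 4^-n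
   is easier to carry through the induction. *)
have bound n : `|F s : R[i]| <= e * `|s : R[i]| * (1 - 4^-1 ^+ n) + `|F (v n) : R[i]|.
  elim: n => [|n IH]; first by rewrite /v expr0 subrr mulr0 add0r mul1r.
  apply: (le_trans IH).
  have Hv : `|F (4 * v n.+1) - F (v n.+1) : R[i]| <= e * `|v n.+1 : R[i]|.
    apply: H; rewrite sub0r normrN nv.
    apply: le_lt_trans sd; rewrite sub0r normrN.
    by rewrite ler_piMl.
  have E : 4 * v n.+1 = v n.
    by rewrite /v exprS !mulrA divff ?mul1r // pnatr_eq0.
  rewrite E nv in Hv.
  have Hn : `|F (v n) : R[i]| <= `|F (v n) - F (v n.+1) : R[i]| + `|F (v n.+1) : R[i]|.
    by rewrite -[in leLHS](subrK (F (v n.+1)) (F (v n))) ler_normD.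
  apply: (le_trans (lerD (lexx _) Hn)); rewrite addrA lerD2r.
  apply: (le_trans (lerD (lexx _) Hv)).
  rewrite exprS; set x : R[i] := 4^-1 ^+ n; set y : R[i] := `|s|.
  have x0 : 0 <= x by rewrite exprn_ge0.
  have -> : e * y * (1 - 4^-1 * x) = e * y * (1 - x) + e * (4^-1 * x * y)
      + e * y * x / 2 by field.
  by rewrite lerDl !mulr_ge0 // /y ?normr_ge0.
apply/ler_addgt0Pr => r r0.
move/(@cvgrPdist_le _ _ _ (nbhs (0 : C)) (nbhs_filter (0 : C))): F0c => /(_ r r0).
move=> /near_ballC [d' d'0 H'].
have [n vn] : exists n, `|v n : R[i]| < d'%:C%C.
  have [S S0 ES] := posc_normc s.
  (* Since 4^n >= n > S / d', the point [v n] lies within [d'] of 0. *)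
  pose n := (Num.truncn (S / d')).+1.
  exists n; rewrite nv ES.
  have -> : (4^-1 : R[i]) ^+ n = ((4^-1 : R) ^+ n)%:C%C.
    by rewrite rmorphXn /= fmorphV rmorph_nat.
  rewrite -rmorphM ltcR exprVn mulrC ltr_pdivrMr ?exprn_gt0 //.
  rewrite mulrC -ltr_pdivrMr //.
  have /lt_le_trans : S / d' < n%:R by rewrite truncnS_gt.
  apply; rewrite -natrX ler_nat.
  exact: ltnW (ltn_expl _ _).
have := bound n; have := H' (v n); rewrite sub0r normrN => /(_ vn).
rewrite F0 sub0r normrN => h1 h2; apply: (le_trans h2); apply: lerD => //.
by rewrite ler_piMr ?mulr_ge0 // gerBl exprn_ge0.
Qed.

(** Comparing linear terms in [sinhroot_quadruple], where [coshroot] has slope 1/2, forces 4 d = d +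
    1/2, that is d = 1/6. *)
Lemma is_derive_sinhroot0 : is_derive (0 : C) 1 sinhroot (6^-1).
Proof.
apply/is_deriveP => e e0.
have s0 : sinhroot (0 : C) = 1 by have := sinhroot_sqr (0 : C); rewrite expr2 mulr0 sinhq0.
(* sinhroot (4 s) = sinhroot s * coshroot s reduces the expansion of sinhroot
   at 0 to that of coshroot. *)
pose F (s : C) : C := sinhroot s - 1 - 6^-1 * s.
suff : \forall s \near (0 : C), `|F s| <= e * `|s|.
  by apply: filterS => s; rewrite addr0 s0.
apply: quadruple_bound.
- have h0 : {for 0, continuous (fun _ : C => 1 : C)} by exact: cst_continuous.
  have h6 : {for 0, continuous (fun _ : C => 6^-1 : C)} by exact: cst_continuous.
  apply: (continuousB (continuousB (@continuous_sinhroot 0) h0)).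
  by apply: (continuousM h6); exact: cvg_id.
- by rewrite /F s0 subrr mulr0 subrr.
- exact: ltW.
have c0 : coshroot (0 : C) = 1.
  by have := coshroot_sqr (0 : C); rewrite expr2 mulr0 => ->; exact: coshc0.
have cS d : 0 < d -> \forall s \near (0 : C), `|sinhroot s - 1 : R[i]| <= d.
  have := @continuous_sinhroot 0; rewrite /continuous_at s0.
  move/(@cvgrPdist_le _ _ _ (nbhs (0 : C)) (nbhs_filter (0 : C))) => h d0.
  by apply: filterS (h _ d0) => s; rewrite distrC.
(* [sinhroot] is at most 2 in modulus near 0, so tolerance e / 4 costs e / 2 and leaves e / 2 for
   the other term. *)
have /is_deriveP/(_ (e / 4)) cC := is_derive_coshroot 0.
have {}cC := cC (divr_gt0 e0 (ltr0n _ 4)).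
apply: filterS3 (cS _ ltr01) (cS _ e0) cC => s.
rewrite addr0 c0 s0 /F sinhroot_quadruple => S1 Se Ce.
have -> : sinhroot s * coshroot s - 1 - 6^-1 * (4 * s)
    - (sinhroot s - 1 - 6^-1 * s)
  = sinhroot s * (coshroot s - 1 - 1 / 2 * s) + (sinhroot s - 1) * (s / 2).
  by move: (sinhroot s : R[i]) (coshroot s : R[i]) (s : R[i]) => p q x; field.
have S2 : `|sinhroot s : R[i]| <= 2.
  rewrite -[sinhroot s](subrK 1) (le_trans (ler_normD _ _)) // normr1.
  by rewrite -[2]/(1 + 1) lerD2r.
have A1 : `|sinhroot s * (coshroot s - 1 - 1 / 2 * s) : R[i]| <= 2 * (e / 4 * `|s|).
  by rewrite normrM ler_pM.
have A2 : `|(sinhroot s - 1) * (s / 2) : R[i]| <= e * (`|s| / 2).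
  rewrite !normrM [X in _ * (_ * X)]ger0_norm ?invr_ge0 ?ler0n //.
  by rewrite ler_wpM2r // divr_ge0.
rewrite (le_trans (ler_normD _ _)) // (le_trans (lerD A1 A2)) //.
by rewrite le_eqVlt; apply/orP; left; apply/eqP; move: (`|s| : R[i]) => n; field.
Qed.

Lemma differentiable_sinhroot (s : C) : differentiable sinhroot s.
Proof.
have [->|/differentiable_sinhroot_neq0 //] := eqVneq s 0.
exact: is_derive_differentiable is_derive_sinhroot0.
Qed.

Lemma differentiable_coshroot (s : C) : differentiable coshroot s.
Proof. exact: is_derive_differentiable (is_derive_coshroot s). Qed.

End HyperbolicRoots.

(** * Maps to the Riemann sphere and their local lifts *)

Section RiemannSphere.
Variable R : realType.
Local Notation C := (Cline R).

(** The point [x : y]. The pair (0, 0) represents no point but is sent to infinity, whence the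
    nonvanishing hypotheses on lifts. *)
Definition proj (x y : C) : P1 R := if y == 0 then None else Some (x / y).

(* f is differentiable at x in homogeneous coordinates. *)
Definition lifts_at (V : normedModType R[i]) (f : V -> P1 R) (x : V) :=
  exists X Y : V -> C, [/\ differentiable X x, differentiable Y x,
    (X x != 0) || (Y x != 0) & \forall y \near x, f y = proj (X y) (Y y)].

(** Neighbourhoods of infinity are defined through compact sets of the plane; continuity there needs
    a radius instead. The norm takes values in [R[i]], so its real part is what gets bounded. *)
Lemma compact_boundedC (K : set C) : compact K ->
  exists2 M : R, 0 < M & forall w : C, K w -> `|w : R[i]| <= M%:C%C.
Proof.
move=> cK.
pose f (w : C) : R^o := complex.Re (`|w : R[i]|).
have fc : continuous f.
  move=> w; apply: (@continuous_comp _ _ _ (fun w : C => `|w| : C) (@complex.Re R : C -> R^o)).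
    exact: norm_continuous.
  exact: continuous_Re.
have /compact_bounded[M [_ HM]] : compact (f @` K).
  by apply: continuous_compact cK; apply: continuous_subspaceT.
exists (`|M| + 1); first by rewrite ltr_wpDl.
move=> w Kw; have := HM (`|M| + 1); rewrite (le_lt_trans (ler_norm M)) ?ltrDl //.
move=> /(_ isT (f w) (ex_intro2 _ _ w Kw erefl)).
by rewrite /f normc_def lecR /= ger0_norm // sqrtr_ge0.
Qed.

Lemma proj_scale (k x y : C) : k != 0 -> proj (k * x) (k * y) = proj x y.
Proof.
move=> k0; rewrite /proj mulf_eq0 (negbTE k0) /=; case: eqP => // /eqP y0.
by congr Some; rewrite invfM mulrACA divff // mul1r.
Qed.

Lemma proj_hcoord (p : P1 R) : proj (hcoord p).1 (hcoord p).2 = p.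
Proof. by case: p => [w|]; rewrite /proj /= ?oner_eq0 ?eqxx // divr1. Qed.

Lemma hcoord_neq0 (p : P1 R) : ((hcoord p).1 != 0) || ((hcoord p).2 != 0).
Proof. by case: p => [w|] /=; rewrite oner_neq0 ?orbT. Qed.

Lemma hcoord_proj (x y : C) : (x != 0) || (y != 0) ->
  exists2 k : C, k != 0 & hcoord (proj x y) = (k * x, k * y).
Proof.
rewrite /proj; have [->|y0] := eqVneq y 0 => /=.
  rewrite ?eqxx orbF => x0; exists x^-1; first by rewrite invr_eq0.
  by rewrite mulVf // mulr0.
by move=> _; exists y^-1; rewrite ?invr_eq0 // mulVf // mulrC.
Qed.

Lemma lifts_at_continuous (V : normedModType R[i]) (f : V -> P1 R) (x : V) :
  lifts_at f x -> {for x, continuous f}.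
Proof.
move=> [X [Y [dX dY XY fXY]]] U.
have cX := differentiable_continuous dX; have cY := differentiable_continuous dY.
rewrite (nbhs_singleton fXY) {1}/proj; case: eqP => [Y0|/eqP Y0].
  move=> [K [/compact_boundedC [M M0 KM] _] KU].
  rewrite Y0 eqxx orbF in XY.
  have M0' : 0 < M%:C%C by rewrite ltcR.
  (* Near [x], |X| stays above |X x| / 2 and |Y| below |X x| / (2 M), so X / Y has modulus above [M]
     and leaves [K]. *)
  have X0 : 0 < `|X x : R[i]| / 2 by rewrite divr_gt0 ?normr_gt0 ?ltr0n.
  have nX : \forall y \near x, `|X x - X y : R[i]| < `|X x : R[i]| / 2.
    by move/(@cvgrPdist_lt _ _ _ (nbhs x) (nbhs_filter x)): cX => /(_ _ X0).
  have nY : \forall y \near x, `|Y y : R[i]| < `|X x : R[i]| / 2 / M%:C%C.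
    move/(@cvgrPdist_lt _ _ _ (nbhs x) (nbhs_filter x)): cY => /(_ _ (divr_gt0 X0 M0')).
    by apply: filterS => y; rewrite Y0 sub0r normrN.
  apply: filterS3 nX nY fXY => y Xy Yy fy /=; rewrite fy.
  apply: KU; rewrite /proj; case: eqP => [_|/eqP Yy0]; [by right|left].
  exists (X y / Y y) => // /KM; rewrite normrM normfV ler_pdivrMr ?normr_gt0 //.
  move=> Xle; move: Yy; rewrite ltr_pdivlMr // mulrC => /(le_lt_trans Xle) X2.
  have := ler_normD (X x - X y) (X y); rewrite subrK => /le_lt_trans /(_ (ltrD Xy X2)).
  by rewrite -mulrDr -[2^-1]mul1r -splitr mulr1 ltxx.
move=> SU.
have cXY := differentiable_continuous (differentiable_mul dX (differentiable_inv dY Y0)).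
have h1 : \forall y \near x, U (Some (X y / Y y)) by exact: cXY _ SU.
have h2 := near_neqV cY Y0.
apply: filterS3 h1 h2 fXY => y /= Uy Yy ->.
by rewrite /proj (negbTE Yy).
Qed.

Lemma lifts_at_wcoord (V : normedModType R[i]) (f : V -> P1 R) (x : V) :
  lifts_at f x -> f x <> P1infty -> differentiable (wcoord \o f) x.
Proof.
move=> [X [Y [dX dY XY fXY]]] fx.
have Y0 : Y x != 0.
  by apply/eqP => Y0; apply: fx; rewrite (nbhs_singleton fXY) /proj Y0 eqxx.
have h := near_neqV (differentiable_continuous dY) Y0.
apply: (@near_eq_differentiable _ V C (fun y => X y / Y y)).
  by apply: filterS2 h fXY => y Yy /= ->; rewrite /proj (negbTE Yy).
exact: differentiable_mul dX (differentiable_inv dY Y0).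
Qed.

Lemma lifts_at_vcoord (V : normedModType R[i]) (f : V -> P1 R) (x : V) :
  lifts_at f x -> f x <> P1zero -> differentiable (vcoord \o f) x.
Proof.
move=> [X [Y [dX dY XY fXY]]] fx.
have X0 : X x != 0.
  apply/eqP => X0; apply: fx; rewrite (nbhs_singleton fXY) /proj X0 mul0r.
  by move: XY; rewrite X0 eqxx /= => /negbTE ->.
have h := near_neqV (differentiable_continuous dX) X0.
apply: (@near_eq_differentiable _ V C (fun y => Y y / X y)).
  apply: filterS2 h fXY => y Xy /= ->; rewrite /proj; case: eqP => [->|_].
    by rewrite mul0r.
  by rewrite /= invfM invrK mulrC.
exact: differentiable_mul dY (differentiable_inv dX X0).
Qed.

Lemma lifts_holomorphic (V : normedModType R[i]) (f : V -> P1 R) :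
  (forall x, lifts_at f x) -> holomorphic_P1 f.
Proof.
move=> H; split=> x; first exact: lifts_at_continuous.
- exact: lifts_at_wcoord.
- exact: lifts_at_vcoord.
Qed.

Lemma near_neq_infty (p : P1 R) : p <> P1infty -> \forall q \near p, q <> P1infty.
Proof.
case: p => // w _.
have : \forall v \near w, (Some v : P1 R) <> P1infty.
  by apply: (@filterE _ (nbhs (w : C)) (nbhs_filter _)) => v; discriminate.
exact.
Qed.

Lemma near_neq_zero (p : P1 R) : p <> P1zero -> \forall q \near p, q <> P1zero.
Proof.
case: p => [w w0|_].
  have : w != 0 by apply/eqP => w0'; apply: w0; rewrite w0'.
  by move/near_neq; apply: filterS => v v0 [] /eqP; exact/negP.
exists [set 0].
  split; first exact: compact_set1.
  apply: accessible_closed_set1; apply: hausdorff_accessible.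
  exact: norm_hausdorff.
by move=> _ [[w w0 <-] [] //|->].
Qed.

(** Converse of [lifts_holomorphic], with lift (w, 1) or (1, v); continuity keeps nearby values in
    the same chart. It is how [sigma] enters the linear computations. *)
Lemma holomorphic_lifts (V : normedModType R[i]) (f : V -> P1 R) (x : V) :
  holomorphic_P1 f -> lifts_at f x.
Proof.
move=> [fc fw fv]; case E : (f x) => [w|].
  have nf : f x <> P1infty by rewrite E.
  exists (wcoord \o f), (cst 1); split.
  - exact: fw.
  - exact: differentiable_cst.
  - by rewrite /cst oner_neq0 orbT.
  - have : \forall y \near x, f y <> P1infty by exact: fc x _ (near_neq_infty nf).
    apply: filterS => y /=.
    by case: (f y) => // v _; rewrite /proj oner_eq0 divr1.
have nf : f x <> P1zero by rewrite E.
exists (cst 1), (vcoord \o f); split.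
- exact: differentiable_cst.
- exact: fv.
- by rewrite /cst oner_neq0.
- have : \forall y \near x, f y <> P1zero by exact: fc x _ (near_neq_zero nf).
  apply: filterS => y /=.
  case: (f y) => [v v0|_]; rewrite /proj /= ?eqxx // invr_eq0 invrK mul1r.
  by case: eqP => // v0'; case: v0; rewrite v0'.
Qed.

Lemma lifts_at_comp (V V' : normedModType R[i]) (f : V -> V') (h : V' -> P1 R) (x : V) :
  differentiable f x -> lifts_at h (f x) -> lifts_at (h \o f) x.
Proof.
move=> df [X [Y [dX dY XY hXY]]]; exists (X \o f), (Y \o f); split.
- exact: differentiable_comp df dX.
- exact: differentiable_comp df dY.
- exact: XY.
exact: differentiable_continuous df _ hXY.
Qed.

End RiemannSphere.

(** * The Riccati flow *)

Section RiccatiFlow.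
Variable R : realType.
Local Notation C := (Cline R).

(* exp (t M) = flowC + flowS M for M = [[B/2, G], [-A, -B/2]], since
   M ^ 2 = disc. *)
Definition disc (A B G : C) : C := B ^+ 2 / 4 - A * G.
Definition flowC (D t : C) : C := coshroot (D * t ^+ 2).
Definition flowS (D t : C) : C := t * sinhroot (D * t ^+ 2).

Lemma flowC_sqr r t : flowC (r ^+ 2) t = coshc (r * t).
Proof. by rewrite /flowC -exprMn coshroot_sqr. Qed.

Lemma flowS_sqr r t : r * flowS (r ^+ 2) t = sinhc (r * t).
Proof. by rewrite /flowS -exprMn sinhroot_sqr sinhqE mulrA. Qed.

Lemma flowS0 t : flowS 0 t = t.
Proof.
have := sinhroot_sqr (0 : C); rewrite expr2 mulr0 sinhq0 /flowS mul0r => ->.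
exact: mulr1.
Qed.

Lemma flowCN D t : flowC D (- t) = flowC D t.
Proof. by rewrite /flowC sqrrN. Qed.

Lemma flowSN D t : flowS D (- t) = - flowS D t.
Proof. by rewrite /flowS sqrrN mulNr. Qed.

Lemma flowC_at0 D : flowC D 0 = 1.
Proof.
rewrite /flowC expr2 mulr0 mulr0; have := coshroot_sqr (0 : C).
rewrite expr2 mulr0 => ->.
exact: coshc0.
Qed.

Lemma flowS_at0 D : flowS D 0 = 0.
Proof. exact: mul0r. Qed.

Lemma flowCS D t : flowC D t ^+ 2 - D * flowS D t ^+ 2 = 1.
Proof.
rewrite -(coshroot_sinhroot (D * t ^+ 2)) /flowC /flowS.
by congr (_ - _); rewrite exprMn; exact: mulrA.
Qed.

Lemma is_derive_flowC (D t : C) : is_derive t 1 (flowC D) (D * flowS D t).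
Proof.
rewrite -[D](sqr_sqrtc (D : R[i])); move: (sqrtc D : C) => r.
have -> : flowC (r ^+ 2) = @coshc R \o (fun s : C => r * s).
  by apply/funext => s; exact: flowC_sqr.
have -> : r ^+ 2 * flowS (r ^+ 2) t = sinhc (r * t) * r.
  by rewrite expr2 -mulrA flowS_sqr mulrC.
exact: is_derive_comp (is_derive_scale r t) (is_derive_coshc _).
Qed.

(** For D = r^2 with r nonzero the function is sinh (r t) / r; for r = 0 it degenerates to the
    identity. *)
Lemma is_derive_flowS (D t : C) : is_derive t 1 (flowS D) (flowC D t).
Proof.
rewrite -[D](sqr_sqrtc (D : R[i])); move: (sqrtc D : C) => r.
have [->|r0] := eqVneq r 0.
  rewrite flowC_sqr mul0r expr2 mulr0.
  have -> : flowS 0 = (fun s => s) by apply/funext => s; exact: flowS0.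
  rewrite coshc0.
  exact: is_derive_idC.
have -> : flowS (r ^+ 2) = (fun s => r^-1 * (@sinhc R \o (fun s : C => r * s)) s).
  by apply/funext => s; rewrite /= -flowS_sqr mulKf.
have h := is_derive_comp (is_derive_scale r t) (is_derive_sinhc (r * t)).
have := is_derive_mul (is_derive_const r^-1 t) h.
by rewrite mul0r add0r flowC_sqr [coshc _ * r]mulrC mulKf.
Qed.

(** [flow_x] and [flow_y] are the two coordinates of exp (t M) applied to the vector (x, y). *)
Definition flow_x (A B G t x y : C) : C :=
  flowC (disc A B G) t * x + flowS (disc A B G) t * (B / 2 * x + G * y).
Definition flow_y (A B G t x y : C) : C :=
  flowC (disc A B G) t * y - flowS (disc A B G) t * (A * x + B / 2 * y).

(** exp (- t M) exp (t M) is the scalar flowC^2 - disc flowS^2, which is 1 by [flowCS]; inserting it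
    on the right leaves a rational identity. *)
Lemma flow_x_inv A B G t x y :
  flow_x A B G (- t) (flow_x A B G t x y) (flow_y A B G t x y) = x.
Proof.
rewrite /flow_x /flow_y flowCN flowSN -[RHS]mulr1 -[X in _ = _ * X](flowCS (disc A B G) t) /disc.
move: (flowC _ _ : R[i]) (flowS _ _ : R[i]) => p q.
by move: (A : R[i]) (B : R[i]) (G : R[i]) (x : R[i]) (y : R[i]) => a b c u v; field.
Qed.

Lemma flow_y_inv A B G t x y :
  flow_y A B G (- t) (flow_x A B G t x y) (flow_y A B G t x y) = y.
Proof.
rewrite /flow_x /flow_y flowCN flowSN -[RHS]mulr1 -[X in _ = _ * X](flowCS (disc A B G) t) /disc.
move: (flowC _ _ : R[i]) (flowS _ _ : R[i]) => p q.
by move: (A : R[i]) (B : R[i]) (G : R[i]) (x : R[i]) (y : R[i]) => a b c u v; field.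
Qed.

Lemma flow_neq0 A B G t x y : (x != 0) || (y != 0) ->
  (flow_x A B G t x y != 0) || (flow_y A B G t x y != 0).
Proof.
apply: contraLR; rewrite !negb_or !negbK => /andP[/eqP X0 /eqP Y0].
have := flow_x_inv A B G t x y; have := flow_y_inv A B G t x y.
rewrite X0 Y0 /flow_x /flow_y !(mulr0, addr0, subr0).
by move=> <- <-; rewrite !eqxx.
Qed.

Lemma flow_scale A B G t k x y :
  flow_x A B G t (k * x) (k * y) = k * flow_x A B G t x y /\
  flow_y A B G t (k * x) (k * y) = k * flow_y A B G t x y.
Proof.
by rewrite /flow_x /flow_y; split; ring.
Qed.

(** The Möbius transformation of the sphere induced by exp (t M). *)
Definition riccati (A B G t : C) (p : P1 R) : P1 R :=
  proj (flow_x A B G t (hcoord p).1 (hcoord p).2)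
       (flow_y A B G t (hcoord p).1 (hcoord p).2).

Lemma riccati_proj A B G t x y : (x != 0) || (y != 0) ->
  riccati A B G t (proj x y) = proj (flow_x A B G t x y) (flow_y A B G t x y).
Proof.
move=> /hcoord_proj [k k0 E]; rewrite /riccati E /=.
by have [-> ->] := flow_scale A B G t k x y; rewrite proj_scale.
Qed.

Lemma riccati0 A B G p : riccati A B G 0 p = p.
Proof.
rewrite -[RHS]proj_hcoord /riccati /flow_x /flow_y flowC_at0 flowS_at0.
by rewrite !mul1r !mul0r addr0 subr0.
Qed.

Lemma riccatiK A B G t p : riccati A B G (- t) (riccati A B G t p) = p.
Proof.
rewrite -{2}[p]proj_hcoord {2}/riccati riccati_proj.
  by rewrite flow_x_inv flow_y_inv.
exact: flow_neq0 (hcoord_neq0 p).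
Qed.

(* Variation of constants: (d/du) exp (s M) h = exp (s M) (h' + s' M h). *)
Lemma is_derive_flow_x A B G (s x y : C -> C) (t ds dx dy : C) :
  is_derive t 1 s ds -> is_derive t 1 x dx -> is_derive t 1 y dy ->
  is_derive t 1 (fun u => flow_x A B G (s u) (x u) (y u))
    (flow_x A B G (s t) (dx + ds * (B / 2 * x t + G * y t))
                        (dy - ds * (A * x t + B / 2 * y t))).
Proof.
move=> hs hx hy.
have hC := is_derive_comp hs (is_derive_flowC (disc A B G) (s t)).
have hS := is_derive_comp hs (is_derive_flowS (disc A B G) (s t)).
have hL := is_derive_add (is_derive_mul (is_derive_const (B / 2) t) hx)
                         (is_derive_mul (is_derive_const G t) hy).
have := is_derive_add (is_derive_mul hC hx) (is_derive_mul hS hL).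
congr (is_derive _ _ _ _).
rewrite /flow_x /= /disc.
move: (flowC _ _ : R[i]) (flowS _ _ : R[i]) => p q.
move: (A : R[i]) (B : R[i]) (G : R[i]) (x t : R[i]) (y t : R[i]) => a b c u v.
by move: (dx : R[i]) (dy : R[i]) (ds : R[i]) => du dv d; field.
Qed.

Lemma is_derive_flow_y A B G (s x y : C -> C) (t ds dx dy : C) :
  is_derive t 1 s ds -> is_derive t 1 x dx -> is_derive t 1 y dy ->
  is_derive t 1 (fun u => flow_y A B G (s u) (x u) (y u))
    (flow_y A B G (s t) (dx + ds * (B / 2 * x t + G * y t))
                        (dy - ds * (A * x t + B / 2 * y t))).
Proof.
move=> hs hx hy.
have hC := is_derive_comp hs (is_derive_flowC (disc A B G) (s t)).
have hS := is_derive_comp hs (is_derive_flowS (disc A B G) (s t)).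
have hL := is_derive_add (is_derive_mul (is_derive_const A t) hx)
                         (is_derive_mul (is_derive_const (B / 2) t) hy).
have := is_derive_sub (is_derive_mul hC hy) (is_derive_mul hS hL).
congr (is_derive _ _ _ _).
rewrite /flow_y /= /disc.
move: (flowC _ _ : R[i]) (flowS _ _ : R[i]) => p q.
move: (A : R[i]) (B : R[i]) (G : R[i]) (x t : R[i]) (y t : R[i]) => a b c u v.
by move: (dx : R[i]) (dy : R[i]) (ds : R[i]) => du dv d; field.
Qed.

(** Coefficients, time and starting point all vary at once, so one statement covers both holomorphy
    in time and joint holomorphy in (z, t). It rests on [coshroot] and [sinhroot] being entire. *)
Lemma riccati_lifts_at (V : normedModType R[i]) (A B G T : V -> C) (f : V -> P1 R) (x : V) :
  differentiable A x -> differentiable B x -> differentiable G x ->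
  differentiable T x -> lifts_at f x ->
  lifts_at (fun y => riccati (A y) (B y) (G y) (T y) (f y)) x.
Proof.
move=> dA dB dG dT [X [Y [dX dY XY fXY]]].
have d2 := differentiable_const (2^-1 : C) x.
have d4 := differentiable_const (4^-1 : C) x.
have dBh := differentiable_mul dB d2.
have dD := differentiable_sub (differentiable_mul (differentiable_mul dB dB) d4)
  (differentiable_mul dA dG).
have dE := differentiable_mul dD (differentiable_mul dT dT).
have dC := differentiable_comp dE (differentiable_coshroot _).
have dS := differentiable_mul dT (differentiable_comp dE (differentiable_sinhroot _)).
exists (fun y => flow_x (A y) (B y) (G y) (T y) (X y) (Y y)).
exists (fun y => flow_y (A y) (B y) (G y) (T y) (X y) (Y y)); split.
- exact: differentiable_add (differentiable_mul dC dX) (differentiable_mul dS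
    (differentiable_add (differentiable_mul dBh dX) (differentiable_mul dG dY))).
- exact: differentiable_sub (differentiable_mul dC dY) (differentiable_mul dS
    (differentiable_add (differentiable_mul dA dX) (differentiable_mul dBh dY))).
- exact: flow_neq0.
have hX := differentiable_continuous dX; have hY := differentiable_continuous dY.
have nXY : \forall y \near x, (X y != 0) || (Y y != 0).
  case/orP: XY => [X0|Y0].
    by apply: filterS (near_neqV hX X0) => y ->.
  by apply: filterS (near_neqV hY Y0) => y ->; rewrite orbT.
by apply: filterS2 nXY fXY => y ny ->; rewrite riccati_proj.
Qed.

(** M commutes with exp (t M), as M^2 is scalar; this rewrites the derivative of the flow as M
    applied to the flow. *)
Lemma flow_x_generator (A B G t x y : C) :
  flow_x A B G t (B / 2 * x + G * y) (- (A * x + B / 2 * y)) =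
  B / 2 * flow_x A B G t x y + G * flow_y A B G t x y.
Proof.
rewrite /flow_x /flow_y /disc.
move: (flowC _ _ : R[i]) (flowS _ _ : R[i]) => p q.
by move: (A : R[i]) (B : R[i]) (G : R[i]) (x : R[i]) (y : R[i]) => a b c u v; field.
Qed.

Lemma flow_y_generator (A B G t x y : C) :
  flow_y A B G t (B / 2 * x + G * y) (- (A * x + B / 2 * y)) =
  - (A * flow_x A B G t x y + B / 2 * flow_y A B G t x y).
Proof.
rewrite /flow_x /flow_y /disc.
move: (flowC _ _ : R[i]) (flowS _ _ : R[i]) => p q.
by move: (A : R[i]) (B : R[i]) (G : R[i]) (x : R[i]) (y : R[i]) => a b c u v; field.
Qed.

Lemma is_derive_flow_x_time (A B G x y t : C) :
  is_derive t 1 (fun s => flow_x A B G s x y)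
    (B / 2 * flow_x A B G t x y + G * flow_y A B G t x y).
Proof.
have := is_derive_flow_x A B G (is_derive_idC t) (is_derive_const x t) (is_derive_const y t).
by rewrite !mul1r add0r sub0r flow_x_generator.
Qed.

Lemma is_derive_flow_y_time (A B G x y t : C) :
  is_derive t 1 (fun s => flow_y A B G s x y)
    (- (A * flow_x A B G t x y + B / 2 * flow_y A B G t x y)).
Proof.
have := is_derive_flow_y A B G (is_derive_idC t) (is_derive_const x t) (is_derive_const y t).
by rewrite !mul1r add0r sub0r flow_y_generator.
Qed.

(** * Existence: the explicit flow integrates the Riccati field *)

Section IntegralCurve.
Variables (a b c u : C -> C) (z : C).
Let A : C := cexp (u z) * a z.
Let B : C := cexp (u z) * b z.
Let G : C := cexp (u z) * c z.

Lemma W_wE w : vf_w (W a b c u) z w = A * w ^+ 2 + B * w + G.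
Proof. by rewrite /= /A /B /G !mulrDr !mulrA. Qed.

Lemma W_vE v : vf_v (W a b c u) z v = - (A + B * v + G * v ^+ 2).
Proof. by rewrite /= /A /B /G !mulrDr !mulrA. Qed.

(** The lift (X, Y) solves a linear system with matrix M; the quotient rule for X / Y and for Y / X
    gives the field in the two charts. *)
Lemma riccati_integral_curve (p : P1 R) :
  integral_curve (W a b c u) (fun t => (z, riccati A B G t p)).
Proof.
have hl t : lifts_at (fun s : C => riccati A B G s p) t.
  apply: (@riccati_lifts_at C (fun=> A) (fun=> B) (fun=> G) (fun s => s) (fun=> p)).
  - exact: differentiable_const.
  - exact: differentiable_const.
  - exact: differentiable_const.
  - exact: is_derive_differentiable (is_derive_idC t).
  exists (fun=> (hcoord p).1), (fun=> (hcoord p).2); split.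
  - exact: differentiable_const.
  - exact: differentiable_const.
  - exact: hcoord_neq0.
  - by apply: (@filterE _ (nbhs (t : C)) (nbhs_filter _)) => s; rewrite proj_hcoord.
split.
  split; last exact: lifts_holomorphic.
  move=> t; exact: differentiable_const.
move=> t; split; first exact: is_derive_const.
- rewrite W_wE /=; set X := fun s => flow_x A B G s (hcoord p).1 (hcoord p).2.
  set Y := fun s => flow_y A B G s (hcoord p).1 (hcoord p).2 => Yt.
  have Y0 : Y t != 0.
    by apply/eqP => Y0; apply: Yt; rewrite /riccati /proj -/(Y t) Y0 eqxx.
  have hY := is_derive_flow_y_time A B G (hcoord p).1 (hcoord p).2 t.
  have hX := is_derive_flow_x_time A B G (hcoord p).1 (hcoord p).2 t.
  have -> : wcoord (riccati A B G t p) = X t / Y t.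
    by rewrite /riccati /proj -/(Y t) (negbTE Y0).
  have nY := near_neqV (is_derive_continuous hY) Y0.
  apply: (@near_eq_is_derive _ C C (fun s => X s / Y s)).
    by apply: filterS nY => s Ys; rewrite /= /riccati /proj (negbTE Ys).
  have := is_derive_div Y0 hX hY; congr (is_derive _ _ _ _).
  rewrite -/(X t) -/(Y t).
  move: (X t : R[i]) (Y t : R[i]) (A : R[i]) (B : R[i]) (G : R[i]) Y0 => x y a' b' c' y0.
  by field.
- rewrite W_vE /=; set X := fun s => flow_x A B G s (hcoord p).1 (hcoord p).2.
  set Y := fun s => flow_y A B G s (hcoord p).1 (hcoord p).2 => Xt.
  have X0 : X t != 0.
    apply/eqP => X0; apply: Xt; rewrite /riccati /proj -/(X t) X0 mul0r -/(Y t).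
    have := flow_neq0 A B G t (hcoord_neq0 p).
    by rewrite -/(X t) X0 eqxx /= => /negbTE ->.
  have hY := is_derive_flow_y_time A B G (hcoord p).1 (hcoord p).2 t.
  have hX := is_derive_flow_x_time A B G (hcoord p).1 (hcoord p).2 t.
  (* The formula also covers [Y s = 0], where the point is infinity and both sides are 0. *)
  have vE s : X s != 0 -> vcoord (riccati A B G s p) = Y s / X s.
    move=> Xs; rewrite /riccati /proj -/(Y s) -/(X s); case: eqP => [->|_].
      by rewrite mul0r.
    by rewrite /= invfM invrK mulrC.
  have nX := near_neqV (is_derive_continuous hX) X0.
  rewrite vE //.
  apply: (@near_eq_is_derive _ C C (fun s => Y s / X s)).
    by apply: filterS nX => s Xs; rewrite /= vE.
  have := is_derive_div X0 hY hX; congr (is_derive _ _ _ _).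
  rewrite -/(X t) -/(Y t).
  move: (X t : R[i]) (Y t : R[i]) (A : R[i]) (B : R[i]) (G : R[i]) X0 => x y a' b' c' x0.
  by field.
Qed.

End IntegralCurve.

(** Both functions solve the same scalar linear equation, so the numerator X' Y - X Y' of the
    derivative of X / Y vanishes. *)
Lemma derive_proportional_near_cst (X Y k : C -> C) (t0 : C) : Y t0 != 0 ->
  (\forall t \near t0, is_derive (t : C) 1 X (k t * X t)) ->
  (\forall t \near t0, is_derive (t : C) 1 Y (k t * Y t)) ->
  \forall t \near t0, Y t != 0 /\ X t / Y t = X t0 / Y t0.
Proof.
move=> Y0 hX hY.
have nY := near_neqV (is_derive_continuous (nbhs_singleton hY)) Y0.
have /derive0_near_cst : \forall t \near t0, is_derive (t : C) 1 (fun s => X s / Y s) 0.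
  apply: filterS3 nY hX hY => t Yt Xd Yd.
  have := is_derive_div Yt Xd Yd; congr (is_derive _ _ _ _).
  have -> : k t * X t * Y t - X t * (k t * Y t) = 0 by ring.
  exact: mul0r.
by apply: filterS2 nY => t.
Qed.

(** A lift whose velocity is a multiple of itself moves only along its own line, so its class on the
    sphere stands still. *)
Lemma proj_near_cst (X Y k : C -> C) (t0 : C) : (X t0 != 0) || (Y t0 != 0) ->
  (\forall t \near t0, is_derive (t : C) 1 X (k t * X t)) ->
  (\forall t \near t0, is_derive (t : C) 1 Y (k t * Y t)) ->
  \forall t \near t0, proj (X t) (Y t) = proj (X t0) (Y t0).
Proof.
case/orP => [X0 hX hY|Y0 hX hY].
  have h := derive_proportional_near_cst X0 hY hX.
  apply: filterS h => t [Xt E].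
  have P s : X s != 0 -> proj (X s) (Y s) = proj 1 (Y s / X s).
    move=> Xs; rewrite -(proj_scale 1 (Y s / X s) Xs) mulr1.
    by rewrite mulrC divfK.
  by rewrite !P // E.
have h := derive_proportional_near_cst Y0 hX hY.
by apply: filterS h => t [Yt E]; rewrite /proj (negbTE Yt) (negbTE Y0) E.
Qed.

(** * Uniqueness of integral curves *)

Section Uniqueness.
Variables (a b c u : C -> C) (z : C).
Let A : C := cexp (u z) * a z.
Let B : C := cexp (u z) * b z.
Let G : C := cexp (u z) * c z.

Lemma integral_curve_fst (X : vertical_field R) (gam : C -> C * P1 R) :
  integral_curve X gam -> forall t, (gam t).1 = (gam 0).1.
Proof.
move=> [_ H]; apply: (@locally_cst R C (fst \o gam)) => t.
apply: derive0_near_cst.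
by apply: (@filterE _ (nbhs (t : C)) (nbhs_filter _)) => s; have [] := H s.
Qed.

(** For the lift h = (w, 1) of an integral curve, h' - M h = (A w + B / 2) h; for h = (1, v) the
    factor is - (B / 2 + G v). By variation of constants exp (- t M) h therefore has velocity
    proportional to itself, and [eta] is locally constant in either chart. *)
Lemma riccati_unique (gam : C -> C * P1 R) :
  integral_curve (W a b c u) gam -> (gam 0).1 = z ->
  forall t, gam t = (z, riccati A B G t (gam 0).2).
Proof.
move=> Hgam z0; have fz t : (gam t).1 = z by rewrite (integral_curve_fst Hgam).
pose eta t := riccati A B G (- t) (gam t).2.
have [[_ [gc _ _]] Hd] := Hgam.
suff loc t0 : \forall t \near t0, eta t = eta t0.
  move=> t; have := locally_cst loc t; rewrite /eta oppr0 riccati0 => <-.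
  have := riccatiK A B G (- t) (gam t).2; rewrite opprK => ->.
  by rewrite -(fz t); case: (gam t).
case E : (gam t0).2 => [w0|].
- have nf : (gam t0).2 <> P1infty by rewrite E.
  have near_w : \forall t \near t0, (gam t).2 <> P1infty.
    exact: gc t0 _ (near_neq_infty nf).
  pose w := wcoord \o (snd \o gam).
  pose X t := flow_x A B G (- t) (w t) 1.
  pose Y t := flow_y A B G (- t) (w t) 1.
  have etaE t : (gam t).2 <> P1infty -> eta t = proj (X t) (Y t).
    by rewrite /eta /X /Y /w /=; case: ((gam t).2).
  have dXY t : (gam t).2 <> P1infty ->
      is_derive t 1 X ((A * w t + B / 2) * X t) /\
      is_derive t 1 Y ((A * w t + B / 2) * Y t).
    move=> gt; have [_ /(_ gt) + _] := Hd t; rewrite fz W_wE => hw.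
    have h1 := is_derive_const (1 : C) t.
    have ho := is_derive_opp t.
    have := is_derive_flow_x A B G ho hw h1; have := is_derive_flow_y A B G ho hw h1.
    rewrite -/(w t) -/A -/B -/G.
    have -> : A * w t ^+ 2 + B * w t + G + -1 * (B / 2 * w t + G * 1)
      = (A * w t + B / 2) * w t.
      by move: (A : R[i]) (B : R[i]) (G : R[i]) (w t : R[i]) => a' b' c' x; field.
    have -> : 0 - -1 * (A * w t + B / 2 * 1) = (A * w t + B / 2) * 1.
      by move: (A : R[i]) (B : R[i]) (w t : R[i]) => a' b' x; field.
    by have [-> ->] := flow_scale A B G (- t) (A * w t + B / 2) (w t) 1.
  have XY0 : (X t0 != 0) || (Y t0 != 0).
    by apply: flow_neq0; rewrite oner_neq0 orbT.
  have h := proj_near_cst (k := fun t => A * w t + B / 2) XY0.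
  have h1 : \forall t \near t0, is_derive (t : C) 1 X ((A * w t + B / 2) * X t).
    by apply: filterS near_w => t /dXY [].
  have h2 : \forall t \near t0, is_derive (t : C) 1 Y ((A * w t + B / 2) * Y t).
    by apply: filterS near_w => t /dXY [].
  by apply: filterS2 near_w (h h1 h2) => t gt; rewrite !etaE.
- have nf : (gam t0).2 <> P1zero by rewrite E.
  have near_v : \forall t \near t0, (gam t).2 <> P1zero.
    exact: gc t0 _ (near_neq_zero nf).
  pose v := vcoord \o (snd \o gam).
  pose X t := flow_x A B G (- t) 1 (v t).
  pose Y t := flow_y A B G (- t) 1 (v t).
  have etaE t : (gam t).2 <> P1zero -> eta t = proj (X t) (Y t).
    move=> gt; rewrite /X /Y -riccati_proj ?oner_neq0 // /eta /v /=.
    congr riccati; case: ((gam t).2) gt => [x x0|_]; rewrite /proj /= ?eqxx //.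
    rewrite invr_eq0 div1r invrK; case: eqP => // x0'.
    by case: x0; rewrite x0'.
  have dXY t : (gam t).2 <> P1zero ->
      is_derive t 1 X (- (B / 2 + G * v t) * X t) /\
      is_derive t 1 Y (- (B / 2 + G * v t) * Y t).
    move=> gt; have [_ _ /(_ gt)] := Hd t; rewrite fz W_vE => hv.
    have h1 := is_derive_const (1 : C) t.
    have ho := is_derive_opp t.
    have := is_derive_flow_x A B G ho h1 hv; have := is_derive_flow_y A B G ho h1 hv.
    rewrite -/(v t) -/A -/B -/G.
    have -> : 0 + -1 * (B / 2 * 1 + G * v t) = - (B / 2 + G * v t) * 1.
      by move: (B : R[i]) (G : R[i]) (v t : R[i]) => b' c' x; field.
    have -> : - (A + B * v t + G * v t ^+ 2) - -1 * (A * 1 + B / 2 * v t)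
      = - (B / 2 + G * v t) * v t.
      by move: (A : R[i]) (B : R[i]) (G : R[i]) (v t : R[i]) => a' b' c' x; field.
    by have [-> ->] := flow_scale A B G (- t) (- (B / 2 + G * v t)) 1 (v t).
  have XY0 : (X t0 != 0) || (Y t0 != 0).
    by apply: flow_neq0; rewrite oner_neq0.
  have h := proj_near_cst (k := fun t => - (B / 2 + G * v t)) XY0.
  have h1 : \forall t \near t0, is_derive (t : C) 1 X (- (B / 2 + G * v t) * X t).
    by apply: filterS near_v => t /dXY [].
  have h2 : \forall t \near t0, is_derive (t : C) 1 Y (- (B / 2 + G * v t) * Y t).
    by apply: filterS near_v => t /dXY [].
  by apply: filterS2 near_v (h h1 h2) => t gt; rewrite !etaE.
Qed.

End Uniqueness.

(** * The invariant quadratic form and the orbits of the flow *)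

Definition quad (A B G x y : C) : C := A * x ^+ 2 + B * (x * y) + G * y ^+ 2.

Lemma quad_scale A B G k x y : quad A B G (k * x) (k * y) = k ^+ 2 * quad A B G x y.
Proof. by rewrite /quad; ring. Qed.

(** The form is det (M h, h), and exp (t M) commutes with M and has determinant 1; the determinant
    enters the computation through [flowCS]. *)
Lemma quad_flow A B G t x y :
  quad A B G (flow_x A B G t x y) (flow_y A B G t x y) = quad A B G x y.
Proof.
rewrite -[RHS]mul1r -[X in _ = X * _](flowCS (disc A B G) t).
rewrite /quad /flow_x /flow_y /disc.
move: (flowC _ _ : R[i]) (flowS _ _ : R[i]) => p q.
by move: (A : R[i]) (B : R[i]) (G : R[i]) (x : R[i]) (y : R[i]) => a b c u v; field.
Qed.

(** The value depends on the representative chosen by [hcoord]; only its vanishing is intrinsic. *)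
Definition quad_P1 A B G (p : P1 R) := quad A B G (hcoord p).1 (hcoord p).2.

Lemma quad_P1_proj A B G x y : (x != 0) || (y != 0) ->
  (quad_P1 A B G (proj x y) == 0) = (quad A B G x y == 0).
Proof.
move=> /hcoord_proj [k k0 E]; rewrite /quad_P1 E /= quad_scale.
by rewrite mulf_eq0 expf_eq0 /= (negbTE k0).
Qed.

Lemma quad_P1_riccati A B G t p :
  (quad_P1 A B G (riccati A B G t p) == 0) = (quad_P1 A B G p == 0).
Proof.
rewrite /riccati quad_P1_proj; last exact: flow_neq0 (hcoord_neq0 p).
by rewrite quad_flow.
Qed.

(* Every P + S M of nonzero determinant is proportional to some exp (t M). *)
Lemma flow_param (D P S : C) : P ^+ 2 - D * S ^+ 2 != 0 ->
  exists t k : C, [/\ k != 0, P = k * flowC D t & S = k * flowS D t].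
Proof.
rewrite -[D](sqr_sqrtc (D : R[i])); move: (sqrtc D : C) => r.
have [->|r0] := eqVneq r 0.
  (* Here M is nilpotent and exp (t M) = 1 + t M, so t = S / P and k = P. *)
  have -> : (0 : C) ^+ 2 = 0 by rewrite expr2 mulr0.
  rewrite mul0r subr0 expf_eq0 /= => P0.
  exists (S / P), P; split => //.
    have -> : (0 : C) = 0 ^+ 2 by rewrite expr2 mulr0.
    have -> : flowC (0 ^+ 2) (S / P) = 1 :> C.
      by rewrite flowC_sqr mul0r coshc0.
    by rewrite mulr1.
  by rewrite flowS0 mulrC divfK.
move=> nz.
(* Dividing by [k] normalises the determinant to 1. The eigenvalues (P + r S) / k and (P - r S) / k
   are then mutually inverse, hence of the form e^x and e^-x, and t = x / r. *)
pose k : C := sqrtc (P ^+ 2 - r ^+ 2 * S ^+ 2).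
have k2 : k ^+ 2 = P ^+ 2 - r ^+ 2 * S ^+ 2 by exact: sqr_sqrtc.
have k0 : k != 0 by rewrite -sqrf_eq0 k2.
have PS : (P + r * S) * (P - r * S) = k ^+ 2 by rewrite k2; ring.
have w0 : (P + r * S) / k != 0.
  rewrite mulf_eq0 invr_eq0 (negbTE k0) orbF; apply/eqP => h.
  by move: PS; rewrite h mul0r => /esym/eqP; rewrite sqrf_eq0 (negbTE k0).
have [x ex] := cexp_surj w0.
have eN : cexp (- x) = (P - r * S) / k.
  apply: (@mulfI R[i] _ w0); rewrite -[in LHS]ex cexpVN.
  by rewrite mulrACA PS -invfM expr2 divff // mulf_neq0.
exists (x / r), k; split => //.
  rewrite flowC_sqr [r * _]mulrC divfK // /coshc ex eN.
  move: (P : R[i]) (r : R[i]) (S : R[i]) (k : R[i]) k0 => p q s l l0.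
  by field.
apply: (@mulfI R[i] _ r0); rewrite mulrCA flowS_sqr [r * (x / r)]mulrC divfK //.
rewrite /sinhc ex eN.
move: (P : R[i]) (r : R[i]) (S : R[i]) (k : R[i]) k0 => p q s l l0.
by field.
Qed.

Lemma riccati_transitive A B G (p q : P1 R) :
  quad_P1 A B G p != 0 -> quad_P1 A B G q != 0 -> exists t, riccati A B G t p = q.
Proof.
rewrite -{2}[q]proj_hcoord /quad_P1 /riccati.
move: (hcoord q) (hcoord p) => [x1 y1] [x0 y0] /= Q0 Q1.
(* P and S are the coordinates of (x1, y1) in the basis h, M h, h = (x0, y0);
   it is a basis because det (h, M h) = - quad A B G x0 y0. *)
pose P := (x1 * (A * x0 + B / 2 * y0) + y1 * (B / 2 * x0 + G * y0)) / quad A B G x0 y0.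
pose S := (y0 * x1 - x0 * y1) / quad A B G x0 y0.
(* This determinant is the ratio of the two values of the form, both nonzero. *)
have PS : P ^+ 2 - disc A B G * S ^+ 2 != 0.
  have -> : P ^+ 2 - disc A B G * S ^+ 2 = quad A B G x1 y1 / quad A B G x0 y0.
    move: Q0; rewrite /P /S /disc /quad.
    move: (A : R[i]) (B : R[i]) (G : R[i]) (x0 : R[i]) (y0 : R[i]) (x1 : R[i]) (y1 : R[i]).
    by move=> a b c x y x' y' Q0; field.
  by rewrite mulf_neq0 // invr_eq0.
have [t [k [k0 kC kS]]] := flow_param PS.
exists t; rewrite -(proj_scale _ _ k0).
have -> : k * flow_x A B G t x0 y0 = P * x0 + S * (B / 2 * x0 + G * y0).
  by rewrite kC kS /flow_x; ring.
have -> : k * flow_y A B G t x0 y0 = P * y0 - S * (A * x0 + B / 2 * y0).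
  by rewrite kC kS /flow_y; ring.
congr proj; move: Q0; rewrite /P /S /quad;
  move: (A : R[i]) (B : R[i]) (G : R[i]) (x0 : R[i]) (y0 : R[i]) (x1 : R[i]) (y1 : R[i]);
  by move=> a b c x y x' y' Q0; field.
Qed.

(** Absorbing the nowhere zero factor e^u into the coefficients leaves the zero locus unchanged. *)
Lemma double_sectionE (a b c : C -> C) (e z : C) (p : P1 R) : e != 0 ->
  double_section a b c (z, p) <-> quad_P1 (e * a z) (e * b z) (e * c z) p = 0.
Proof.
move=> e0; rewrite /double_section /quad_P1 /quad /=.
case: (hcoord p) => x y /=.
rewrite -!mulrA -!mulrDr.
split=> [->|/eqP]; first by rewrite mulr0.
by rewrite mulf_eq0 (negbTE e0) => /eqP.
Qed.

(** The first component is z, so the Jacobian matrix is triangular and its determinant is the time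
    derivative of the second component. At (0, 0) this is the field at [sigma 0], nonzero off the
    double section. *)
Lemma W_flow_dominating (a b c u : C -> C) (sigma : C -> P1 R)
    (psi : C -> C * P1 R -> C * P1 R) :
  is_flow (W a b c u) psi -> ~ double_section a b c (0, sigma 0) ->
  (forall t z, (psi t (z, sigma z)).1 = z) ->
  dominating (fun zt : C * C => psi zt.2 (zt.1, sigma zt.1)).
Proof.
move=> Hpsi hD hfst; set g := fun zt => _.
have E00 : g (0, 0) = (0, sigma 0) by have [] := Hpsi (0, sigma 0).
have fstE (q : C * C) : (g q).1 = q.1 by exact: hfst.
have J (h : P1 R -> C) (d : C) : d != 0 ->
    is_derive (0 : C) 1 (h \o (snd \o (fun t => psi t (0, sigma 0)))) d ->
    jacobian_det (fun q => ((g q).1, h (g q).2)) (0, 0) != 0.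
  move=> d0 [_ hd].
  rewrite /jacobian_det.
  have E1 : fst \o (fun q => ((g q).1, h (g q).2)) = fst.
    by apply/funext => q; rewrite /= fstE.
  rewrite E1 !derive_fst /= mul1r mul0r subr0 derive_line.
  rewrite -(_ : h \o (snd \o (fun t => psi t (0, sigma 0))) = fun t => _).
    by rewrite hd.
  apply/funext => x /=; congr h; congr snd; rewrite /g /=.
  by rewrite !addr0 scaler0 [x *: 1]mulr1.
exists (0, 0).
have [_ [_ /(_ 0) [_ hw hv]]] := Hpsi (0, sigma 0).
have P0 : psi 0 (0, sigma 0) = (0, sigma 0) by exact: E00.
have hQ : quad_P1 (cexp (u 0) * a 0) (cexp (u 0) * b 0) (cexp (u 0) * c 0) (sigma 0) != 0.
  by apply/eqP => h; apply: hD; apply/(double_sectionE a b c 0 _ (cexp_neq0 (u 0))).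
case E : (sigma 0) => [w|]; rewrite E /quad_P1 /quad /= in hQ.
- have nf : (psi 0 (0, sigma 0)).2 <> P1infty by rewrite P0 /= E.
  left; split; first exact: nf.
  apply: J (hw nf); rewrite P0 W_wE /= E /=.
  by move: hQ; rewrite mulr1 expr1n mulr1.
- have nf : (psi 0 (0, sigma 0)).2 <> P1zero by rewrite P0 /= E.
  right; split; first exact: nf.
  apply: J (hv nf); rewrite P0 W_vE /= E /= oppr_eq0.
  by move: hQ; rewrite !expr2 !mulr0 !addr0 !mulr1.
Qed.

Lemma entire_cexp (u : C -> C) : entire u -> entire (fun z => cexp (u z)).
Proof.
move=> hu z; exact: differentiable_comp (hu z)
  (is_derive_differentiable (is_derive_cexp (u z))).
Qed.

Lemma entire_mul (f g : C -> C) : entire f -> entire g -> entire (fun z => f z * g z).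
Proof. by move=> hf hg z; exact: differentiable_mul. Qed.

End RiccatiFlow.

Theorem theorem2 (R : realType) (a b c : Cline R -> Cline R)
    (ha : entire a) (hb : entire b) (hc : entire c)
    (hD : double_section a b c <> setT)
    (sigma : Cline R -> P1 R) (hsigma : holomorphic_P1 sigma)
    (hdisj : forall z, ~ double_section a b c (z, sigma z)) :
  forall u : Cline R -> Cline R, entire u ->
    complete_field (W a b c u) /\
    forall psi : Cline R -> Cline R * P1 R -> Cline R * P1 R,
      is_flow (W a b c u) psi ->
      let g := fun zt : Cline R * Cline R => psi zt.2 (zt.1, sigma zt.1) in
      [/\ holomorphic_CP1 g, fiber_preserving g, dominating g
        & range g = ~` double_section a b c].
Proof.
move=> u hu; split.
  move=> [z p]; eexists; split; first exact: riccati_integral_curve.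
  by congr (_, _); exact: riccati0.
move=> psi Hpsi g.
pose A z := cexp (u z) * a z.
pose B z := cexp (u z) * b z.
pose G z := cexp (u z) * c z.
(* A flow is only required to be holomorphic in t; uniqueness replaces it by the explicit formula,
   which is holomorphic in (z, t). *)
have psiE t z p : psi t (z, p) = (z, riccati (A z) (B z) (G z) t p).
  have [p0 hp] := Hpsi (z, p).
  by rewrite (riccati_unique (z := z) hp) p0.
have gE : g = fun zt : Cline R * Cline R =>
    (zt.1, riccati (A zt.1) (B zt.1) (G zt.1) zt.2 (sigma zt.1)).
  by apply/funext => zt; rewrite /g psiE.
have hA : entire A := entire_mul (entire_cexp hu) ha.
have hB : entire B := entire_mul (entire_cexp hu) hb.
have hG : entire G := entire_mul (entire_cexp hu) hc.
have d1 (q : Cline R * Cline R) :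
    differentiable (fst : Cline R * Cline R -> Cline R) q.
  exact: differentiable_fst.
have d2 (q : Cline R * Cline R) :
    differentiable (snd : Cline R * Cline R -> Cline R) q.
  exact: differentiable_snd.
split.
- rewrite gE; split; first exact: d1.
  apply: lifts_holomorphic => q.
  apply: (riccati_lifts_at (A := A \o fst) (B := B \o fst) (G := G \o fst) (T := snd)
    (f := sigma \o fst)).
  + exact: differentiable_comp (d1 q) (hA _).
  + exact: differentiable_comp (d1 q) (hB _).
  + exact: differentiable_comp (d1 q) (hG _).
  + exact: d2.
  + exact: lifts_at_comp (d1 q) (holomorphic_lifts _ hsigma).
- by move=> q; rewrite gE.
- apply: W_flow_dominating Hpsi _ _ => // t z.
  by rewrite psiE.
(* The image avoids the double section because vanishing of the form is preserved along orbits; it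
   is everything else by transitivity on each fibre. *)
apply/seteqP; split => [_ [q _ <-] /=|[z p] /= hp].
  rewrite gE => /(double_sectionE _ _ _ _ _ (cexp_neq0 (u q.1))) /eqP.
  rewrite quad_P1_riccati => /eqP h; apply: (hdisj q.1).
  exact/(double_sectionE _ _ _ _ _ (cexp_neq0 (u q.1))).
have nz q : ~ double_section a b c (z, q) -> quad_P1 (A z) (B z) (G z) q != 0.
  by move=> hq; apply/eqP => h; apply/hq/(double_sectionE _ _ _ _ _ (cexp_neq0 (u z))).
have [t ht] := riccati_transitive (nz _ (hdisj z)) (nz _ hp).
by exists (z, t) => //; rewrite gE /= ht.
Qed.
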